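(* Let $k$ be a positive integer and let $E:\mathbb{R}^3\to\mathbb{R}$ be a continuous function. Then, for every $\varepsilon\in\mathbb{R}$ with $|\varepsilon|\neq0$ sufficiently small, the differential equation $$\ddot x=-x+\varepsilon\,(x^2+\dot x^2)+\varepsilon^k\,\dot x\,\sqrt[3]{x^2+\dot x^2-1}+\varepsilon^{k+1}E(x,\dot x,\varepsilon)$$ admits a periodic solution $x(t;\varepsilon)$ satisfying $(x(t;\varepsilon),\dot x(t;\varepsilon))\to\mathbb{S}^1$ uniformly as $\varepsilon\to0$.
   Context: $\mathbb{S}^1=\{(x,\dot x)\in\mathbb{R}^2: x^2+\dot x^2=1\}$, and $\sqrt[3]{\cdot}$ is the real cube root. The convergence $(x(t;\varepsilon),\dot x(t;\varepsilon))\to\mathbb{S}^1$ uniformly means that the distance from $(x(t;\varepsilon),\dot x(t;\varepsilon))$ to $\mathbb{S}^1$ tends to $0$, uniformly in $t$, as $\varepsilon\to0$. *)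

(* Defs.v *)
From Stdlib Require Import Reals Lra.
From Coquelicot Require Import Coquelicot.
Open Scope R_scope.

(** Stdlib's [Rpower] satisfies [Rpower 0 y = 1]; the factor [sign u] restores
    the value [0] at [u = 0]. *)
Definition cbrt (u : R) : R := sign u * Rpower (Rabs u) (1 / 3).

Lemma cbrt_pow3 (u : R) : cbrt u ^ 3 = u.
Proof.
unfold cbrt.
destruct (Req_dec u 0) as [-> | Hu].
{ rewrite sign_0; ring. }
assert (H : Rpower (Rabs u) (1 / 3) ^ 3 = Rabs u).
{ assert (Hp := Rabs_pos_lt u Hu).
  rewrite <- Rpower_pow by apply exp_pos.
  rewrite Rpower_mult.
  replace (1 / 3 * INR 3) with 1 by (simpl; field).
  now apply Rpower_1. }
rewrite Rpow_mult_distr, H.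
destruct (Rdichotomy u 0 Hu) as [Hn | Hp].
- rewrite sign_eq_m1, Rabs_left by lra; ring.
- rewrite sign_eq_1, Rabs_right by lra; ring.
Qed.

Definition rhs (k : nat) (E : R * R * R -> R) (eps x v : R) : R :=
  - x + eps * (x ^ 2 + v ^ 2)
  + eps ^ k * v * cbrt (x ^ 2 + v ^ 2 - 1)
  + eps ^ (k + 1) * E (x, v, eps).

Definition is_solution (k : nat) (E : R * R * R -> R) (eps : R) (x : R -> R)
  : Prop :=
  forall t : R,
    ex_derive x t /\ is_derive (Derive x) t (rhs k E eps (x t) (Derive x t)).

(** As usual for differential equations, equilibria do not count as periodic
    solutions. *)
Definition periodic (x : R -> R) : Prop :=
  (exists T : R, 0 < T /\ forall t : R, x (t + T) = x t) /\
  (exists s t : R, x s <> x t).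

Definition S1 (p : R * R) : Prop := fst p ^ 2 + snd p ^ 2 = 1.

(** Coquelicot's product structure on [R * R] carries the sup distance, hence
    the explicit Euclidean one. *)
Definition dist2 (p q : R * R) : R :=
  sqrt ((fst p - fst q) ^ 2 + (snd p - snd q) ^ 2).

Definition dist_set (p : R * R) (A : R * R -> Prop) : R :=
  real (Glb_Rbar (fun d : R => exists q : R * R, A q /\ d = dist2 p q)).

(* Main.v *)
Require Import Defs.
From Stdlib Require Import Reals Lra Lia ZArith Classical IndefiniteDescription.
From Coquelicot Require Import Coquelicot.
From mathcomp Require filter.
Open Scope R_scope.

(** Write [x = exp s * cos th], [x' = - exp s * sin th]. Near the unit circle and for
    small [eps] the angle [th] increases with speed between [1/2] and [3/2], so the
    orbits are the graphs of the solutions of a scalar equation [ds/dth = f th s]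
    whose right-hand side is [2 PI]-periodic in [th] and bounded by a multiple of
    [|eps|] ([polar_field_bounds]). A [2 PI]-periodic solution [s] with
    [|s| <= C * |eps|] yields the periodic orbit: the time law [th] of the angle
    solves an autonomous one-dimensional equation ([autonomous_flow]), and the orbit
    stays at distance at most [2 * C * |eps|] from the circle.

    The term [eps * (x^2 + x'^2)] is larger than the others and would hide them, but
    it is integrable: without the remaining terms [exp (-2 eps x) * (x^2 + x'^2)] is
    constant. Half the logarithm of this quantity, [s - eps * exp s * cos th], has
    derivative in [th] of size [eps ^ k] ([first_integral_derive]), with main part
    [eps ^ k * sin th ^ 2 * cbrt (exp (2 s) - 1)] and an error
    [O(|eps| ^ (k + 1))]. If [s] starts at [K * |eps|] with [K] large, it remains
    above a multiple of [|eps|] during a turn; there the cube root is of order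
    [|eps| ^ (1/3)], much larger than [|eps|], so after one turn [s] has moved in
    the direction of the sign of [eps ^ k]. Starting from [- K * |eps|] it moves in
    the opposite direction ([return_sign]).

    A return map with such a sign change should have a fixed point. But [E] is merely
    continuous and the cube root is not Lipschitz, so solutions need not be unique
    and there is no return map. The Euler scheme has one, and it is continuous:
    the intermediate value theorem gives a closed Euler polygon for every fine mesh,
    and the limit of these polygons is a periodic solution
    ([periodic_solution_between]). Limits are taken along a free ultrafilter on
    [nat], which assigns limits to the values at all angles simultaneously. *)

(** * Limits along an ultrafilter *)

Record free_ultrafilter (U : (nat -> Prop) -> Prop) : Prop := {
  ultra_proper :: ProperFilter U;
  ultra_dichotomy : forall P : nat -> Prop, U P \/ U (fun n => ~ P n);
  ultra_free : forall N : nat, U (fun n => (N <= n)%nat) }.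

Lemma free_ultrafilter_exists : exists U, free_ultrafilter U.
Proof.
assert (HF : filter.ProperFilter
               (fun P : nat -> Prop => exists N, forall n, (N <= n)%nat -> P n)).
{ split.
  - intros [N H]. exact (H N (le_n N)).
  - split.
    + now exists O.
    + intros P Q [N HN] [M HM]. exists (N + M)%nat.
      intros n Hn. split; [apply HN | apply HM]; lia.
    + intros P Q HPQ [N HN]. exists N. intros n Hn. apply HPQ, HN, Hn. }
destruct (filter.ultraFilterLemma HF) as [U [HU HFU]].
assert (HP := @filter.ultra_proper _ _ HU).
assert (HU' := @filter.filter_filter _ _ HP).
assert (Himp : forall P Q : nat -> Prop, (forall n, P n -> Q n) -> U P -> U Q)
  by exact (@filter.filterS _ _ HU').
exists U. split.
- split.
  + intros P HUP. apply NNPP. intros Hno.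
    apply (@filter.filter_not_empty _ _ HP).
    revert HUP. apply Himp. intros n Hn. apply Hno. now exists n.
  + split.
    * exact (@filter.filterT _ _ HU').
    * intros P Q. exact (@filter.filterI _ _ HU' P Q).
    * exact Himp.
- intros P. exact (filter.in_ultra_setVsetC P HU).
- intros N. apply HFU. now exists N.
Qed.

(** Bolzano-Weierstrass without subsequences: one ultrafilter picks the limits of
    all bounded sequences at the same time, which replaces the diagonal extraction
    of the Arzela-Ascoli theorem. *)
Lemma ultralimit_exists (U : (nat -> Prop) -> Prop) (HU : free_ultrafilter U)
  (u : nat -> R) (B : R) :
  (forall n, Rabs (u n) <= B) -> exists l, filterlim u U (locally l).
Proof.
intros Hu. assert (FU := ultra_proper U HU).
destruct (completeness (fun c => U (fun n => c <= u n))) as [l [Hub Hlub]].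
- exists B. intros c Hc. destruct (filter_ex _ Hc) as [n Hn].
  assert (H := Hu n). apply Rabs_le_between in H. lra.
- exists (- B). apply filter_forall. intros n.
  assert (H := Hu n). apply Rabs_le_between in H. lra.
- exists l. apply filterlim_locally. intros eta. assert (He := cond_pos eta).
  assert (Hhi : U (fun n => u n < l + eta)).
  { destruct (ultra_dichotomy U HU (fun n => l + eta <= u n)) as [H | H].
    - apply Hub in H. lra.
    - revert H. apply filter_imp. intros n Hn. lra. }
  assert (Hlo : U (fun n => l - eta < u n)).
  { destruct (ultra_dichotomy U HU (fun n => l - eta < u n)) as [H | H]; [exact H|].
    exfalso. enough (l <= l - eta) by lra. apply Hlub. intros c Hc.
    destruct (filter_ex _ (filter_and _ _ H Hc)) as [n Hn]. lra. }
  generalize (filter_and _ _ Hlo Hhi). apply filter_imp. intros n Hn.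
  apply Rabs_lt_between'. lra.
Qed.

Lemma is_lim_seq_ultralimit (U : (nat -> Prop) -> Prop) (HU : free_ultrafilter U)
  (u : nat -> R) (l : R) : is_lim_seq u l -> filterlim u U (locally l).
Proof.
intros Hu P HP. destruct (Hu P HP) as [N HN].
assert (FU := ultra_proper U HU).
unfold filtermap. generalize (ultra_free U HU N). apply filter_imp. exact HN.
Qed.

Lemma filterlim_Rabs_lt (U : (nat -> Prop) -> Prop) (FU : ProperFilter U)
  (u : nat -> R) (l eta : R) :
  filterlim u U (locally l) -> 0 < eta -> U (fun n => Rabs (u n - l) < eta).
Proof.
intros Hu He. exact (proj1 (filterlim_locally u l) Hu (mkposreal eta He)).
Qed.

(** * Euler schemes and their limits *)

Fixpoint euler (f : R -> R -> R) (h c : R) (j : nat) : R :=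
  match j with
  | O => c
  | S i => euler f h c i + h * f (INR i * h) (euler f h c i)
  end.

Lemma euler_secant (f : R -> R -> R) (h c slope eta : R) (i m : nat) :
  0 <= h ->
  (forall j, (i <= j < i + m)%nat ->
     Rabs (f (INR j * h) (euler f h c j) - slope) <= eta) ->
  Rabs (euler f h c (i + m) - euler f h c i - slope * (INR m * h))
    <= eta * (INR m * h).
Proof.
intros Hh. induction m as [| m IH]; intros Hf.
- rewrite Nat.add_0_r. simpl INR.
  replace (_ - _ - _) with 0 by ring. rewrite Rabs_R0. lra.
- rewrite Nat.add_succ_r, S_INR. cbn [euler].
  set (y := euler f h c (i + m)) in *. set (fy := f (INR (i + m) * h) y) in *.
  replace (y + h * fy - euler f h c i - slope * ((INR m + 1) * h))
    with ((y - euler f h c i - slope * (INR m * h)) + h * (fy - slope)) by ring.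
  eapply Rle_trans; [apply Rabs_triang|].
  assert (H1 := IH (fun j Hj => Hf j ltac:(lia))).
  assert (H2 := Hf (i + m)%nat ltac:(lia)). fold y fy in H2.
  rewrite Rabs_mult, (Rabs_right h) by lra.
  assert (h * Rabs (fy - slope) <= h * eta) by now apply Rmult_le_compat_l.
  lra.
Qed.

Lemma euler_continuous (f : R -> R -> R) (h : R) (j : nat) :
  (forall t y, continuity_2d_pt f t y) -> continuity (fun c => euler f h c j).
Proof.
intros Hf. induction j as [| j IH]; intros c; cbn [euler].
- apply derivable_continuous_pt, derivable_pt_id.
- apply continuity_pt_plus; [apply IH|].
  apply continuity_pt_scal. apply continuity_pt_filterlim.
  apply (continuous_comp (fun c => euler f h c j) (f (INR j * h))).
  + apply continuity_pt_filterlim, IH.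
  + apply (continuous_comp_2 (fun _ => INR j * h) (fun y : R => y) f).
    * apply continuous_const.
    * apply continuous_id.
    * exact (proj1 (continuity_2d_pt_filterlim f _ _) (Hf _ _)).
Qed.

(** A fixed point of the discrete return map starts a periodic polygon, because the
    recursion repeats itself after one period. *)
Lemma euler_periodic (f : R -> R -> R) (h c T : R) (N : nat) :
  (forall t y, f (t + T) y = f t y) -> INR N * h = T -> euler f h c N = c ->
  forall j, euler f h c (j + N) = euler f h c j.
Proof.
intros Hf HN Hc. induction j as [| j IH]; [exact Hc|].
cbn [euler Nat.add]. rewrite IH, plus_INR, Rmult_plus_distr_r, HN, Hf. reflexivity.
Qed.

Definition step_index (h t : R) : nat := Z.to_nat (Int_part (t / h)).

Lemma step_index_spec (h t : R) : 0 < h -> 0 <= t ->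
  INR (step_index h t) * h <= t < INR (step_index h t) * h + h.
Proof.
intros Hh Ht. unfold step_index.
assert (H0 : 0 <= t / h) by (apply Rdiv_le_0_compat; lra).
destruct (base_Int_part (t / h)) as [H1 H2].
assert (Hz : (0 <= Int_part (t / h))%Z).
{ enough (-1 < Int_part (t / h))%Z by lia. apply lt_IZR. lra. }
rewrite INR_IZR_INZ, Z2Nat.id by exact Hz.
assert (Ht' : t = t / h * h) by (field; lra).
split; nra.
Qed.

Lemma step_index_unique (h t : R) (j : nat) : 0 < h ->
  INR j * h <= t < INR j * h + h -> step_index h t = j.
Proof.
intros Hh Hj. unfold step_index.
rewrite <- (Int_part_spec (t / h) (Z.of_nat j)); [apply Nat2Z.id|].
rewrite <- INR_IZR_INZ. assert (Ht' : t = t / h * h) by (field; lra).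
split; nra.
Qed.

Lemma step_index_mono (h t1 t2 : R) : 0 < h -> 0 <= t1 <= t2 ->
  (step_index h t1 <= step_index h t2)%nat.
Proof.
intros Hh Ht.
assert (H1 := step_index_spec h t1 Hh ltac:(lra)).
assert (H2 := step_index_spec h t2 Hh ltac:(lra)).
apply Nat.lt_succ_r, INR_lt. rewrite S_INR. nra.
Qed.

Lemma step_index_shift (h t : R) (N : nat) : 0 < h -> 0 <= t ->
  step_index h (t + INR N * h) = (step_index h t + N)%nat.
Proof.
intros Hh Ht. apply step_index_unique; [exact Hh|].
assert (H1 := step_index_spec h t Hh Ht). rewrite plus_INR. lra.
Qed.

(** Piecewise constant interpolation is enough, since the polygons are only ever
    compared up to one mesh width. *)
Definition euler_step (f : R -> R -> R) (h c t : R) : R :=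
  euler f h c (step_index h t).

Lemma euler_step_secant (f : R -> R -> R) (h c slope eta t1 t2 : R) :
  0 < h -> 0 <= t1 <= t2 ->
  (forall j, (step_index h t1 <= j < step_index h t2)%nat ->
     Rabs (f (INR j * h) (euler f h c j) - slope) <= eta) -> 0 <= eta ->
  Rabs (euler_step f h c t2 - euler_step f h c t1 - slope * (t2 - t1))
    <= eta * (t2 - t1) + (eta + Rabs slope) * h.
Proof.
intros Hh Ht Hf He.
assert (H1 := step_index_spec h t1 Hh ltac:(lra)).
assert (H2 := step_index_spec h t2 Hh ltac:(lra)).
assert (H12 := step_index_mono h t1 t2 Hh Ht).
unfold euler_step. revert H1 H2 H12 Hf.
generalize (step_index h t1) (step_index h t2). intros i i' H1 H2 H12 Hf.
destruct (Nat.le_exists_sub _ _ H12) as [m [-> _]].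
rewrite (Nat.add_comm m i) in *. rewrite plus_INR in H2.
assert (H := euler_secant f h c slope eta i m ltac:(lra) Hf).
set (d := euler f h c (i + m) - euler f h c i) in *.
replace (d - slope * (t2 - t1))
  with ((d - slope * (INR m * h)) + slope * (INR m * h - (t2 - t1))) by ring.
eapply Rle_trans; [apply Rabs_triang|]. rewrite (Rabs_mult slope).
assert (Hd : Rabs (INR m * h - (t2 - t1)) <= h) by (apply Rabs_le; lra).
assert (Rabs slope * Rabs (INR m * h - (t2 - t1)) <= Rabs slope * h)
  by (apply Rmult_le_compat_l; [apply Rabs_pos | exact Hd]).
apply Rabs_le_between in Hd.
assert (eta * (INR m * h) <= eta * (t2 - t1 + h)) by (apply Rmult_le_compat_l; lra).
lra.
Qed.

(** The derivative is asked for only at positive times: an Euler scheme says nothing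
    about the past of its starting point. The Lipschitz bound is what survives at
    time [0], where it gives continuity, and it confines the solution. *)
Definition solves_forward (f : R -> R -> R) (M : R) (s : R -> R) : Prop :=
  (forall t, 0 < t -> is_derive s t (f t (s t))) /\
  (forall t1 t2, 0 <= t1 <= t2 -> Rabs (s t2 - s t1) <= M * (t2 - t1)).

Lemma is_derive_of_secant (g : R -> R) (x l : R) :
  (forall eta, 0 < eta -> exists delta, 0 < delta /\ forall y, Rabs (y - x) < delta ->
     Rabs (g y - g x - l * (y - x)) <= eta * Rabs (y - x)) ->
  is_derive g x l.
Proof.
intros H. apply is_derive_Reals. intros eta He.
destruct (H (eta / 2) ltac:(lra)) as [d [Hd Hg]].
exists (mkposreal d Hd). intros k Hk Hkd. simpl in Hkd.
assert (Hk' := Rabs_pos_lt k Hk).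
specialize (Hg (x + k)). replace (x + k - x) with k in Hg by ring.
specialize (Hg Hkd).
replace ((g (x + k) - g x) / k - l) with ((g (x + k) - g x - l * k) / k)
  by now field.
unfold Rdiv at 1. rewrite Rabs_mult, Rabs_inv.
apply Rle_lt_trans with (eta / 2 * Rabs k * / Rabs k).
- apply Rmult_le_compat_r; [left; now apply Rinv_0_lt_compat | exact Hg].
- rewrite Rmult_assoc, Rinv_r by lra. lra.
Qed.

(** Peano's theorem. Near [(t0, s t0)] the slopes of the schemes are all within [eta]
    of [f t0 (s t0)], so their increments are too ([euler_step_secant]), and this
    passes to the limit at the two times concerned. Pointwise limits suffice, since
    the common Lipschitz bound keeps the intermediate values close to [s t0]. *)
Lemma euler_limit_solves (U : (nat -> Prop) -> Prop) (HU : free_ultrafilter U)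
  (f : R -> R -> R) (M : R) (h c : nat -> R) (s : R -> R) :
  (forall t y, continuity_2d_pt f t y) -> (forall t y, Rabs (f t y) <= M) ->
  (forall n, 0 < h n) -> is_lim_seq h 0 ->
  (forall t, 0 <= t -> filterlim (fun n => euler_step f (h n) (c n) t) U (locally (s t))) ->
  solves_forward f M s.
Proof.
intros Hf HM Hh Hh0 Hs. assert (FU := ultra_proper U HU).
assert (M0 : 0 <= M) by (eapply Rle_trans; [apply Rabs_pos | apply (HM 0 0)]).
assert (Hsmall : forall eta, 0 < eta -> U (fun n => h n < eta)).
{ intros eta He.
  generalize (filterlim_Rabs_lt U FU h 0 eta (is_lim_seq_ultralimit U HU h 0 Hh0) He).
  apply filter_imp. intros n Hn. apply Rabs_lt_between in Hn. lra. }
assert (Hpass : forall t1 t2 slope eta, 0 <= t1 <= t2 -> 0 <= eta ->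
  U (fun n => forall j, (step_index (h n) t1 <= j < step_index (h n) t2)%nat ->
     Rabs (f (INR j * h n) (euler f (h n) (c n) j) - slope) <= eta) ->
  Rabs (s t2 - s t1 - slope * (t2 - t1)) <= eta * (t2 - t1)).
{ intros t1 t2 slope eta Ht He Hev. apply Rle_plus_epsilon. intros e He0.
  assert (Hp := Rabs_pos slope).
  assert (Hq : 0 < e / (2 * (eta + Rabs slope + 1))) by (apply Rdiv_lt_0_compat; lra).
  assert (Hev1 := filterlim_Rabs_lt U FU _ _ (e / 4) (Hs t1 ltac:(lra)) ltac:(lra)).
  assert (Hev2 := filterlim_Rabs_lt U FU _ _ (e / 4) (Hs t2 ltac:(lra)) ltac:(lra)).
  assert (Hev12 := filter_and _ _ Hev1 Hev2).
  assert (Hev' := filter_and _ _ Hev (Hsmall _ Hq)).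
  destruct (filter_ex _ (filter_and _ _ Hev' Hev12)) as [n [[H1 H2] [H3 H4]]].
  assert (H5 := euler_step_secant f (h n) (c n) slope eta t1 t2 (Hh n) Ht H1 He).
  assert (H6 : (eta + Rabs slope) * h n <= e / 2).
  { apply (Rmult_lt_compat_r (2 * (eta + Rabs slope + 1))) in H2; [|lra].
    replace (e / (2 * (eta + Rabs slope + 1)) * (2 * (eta + Rabs slope + 1)))
      with e in H2 by (field; lra).
    assert (Hn := Hh n). lra. }
  apply Rabs_le_between in H5. apply Rabs_lt_between in H3, H4.
  apply Rabs_le. lra. }
assert (Hlip : forall n t1 t2, 0 <= t1 <= t2 -> forall j,
  (step_index (h n) t1 <= j <= step_index (h n) t2)%nat ->
  Rabs (euler f (h n) (c n) j - euler_step f (h n) (c n) t1) <= M * (t2 - t1 + h n) /\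
  Rabs (euler_step f (h n) (c n) t2 - euler f (h n) (c n) j) <= M * (t2 - t1 + h n) /\
  t1 - h n <= INR j * h n <= t2).
{ intros n t1 t2 Ht j Hj.
  assert (H0 := Hh n).
  assert (H1 := step_index_spec (h n) t1 H0 ltac:(lra)).
  assert (H2 := step_index_spec (h n) t2 H0 ltac:(lra)).
  unfold euler_step. revert H1 H2 Hj.
  generalize (step_index (h n) t1) (step_index (h n) t2). intros i i' H1 H2 Hj.
  destruct (Nat.le_exists_sub i j) as [m [-> _]]; [lia|].
  destruct (Nat.le_exists_sub (m + i) i') as [m' [-> _]]; [lia|].
  rewrite (Nat.add_comm m' _), (Nat.add_comm m i) in *. rewrite !plus_INR in *.
  assert (L : forall i m, Rabs (euler f (h n) (c n) (i + m) - euler f (h n) (c n) i)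
                          <= M * (INR m * h n)).
  { intros i0 m0.
    assert (H := euler_secant f (h n) (c n) 0 M i0 m0 ltac:(lra)).
    rewrite Rmult_0_l, Rminus_0_r in H. apply H.
    intros k _. rewrite Rminus_0_r. apply HM. }
  assert (Hm := pos_INR m). assert (Hm' := pos_INR m').
  assert (0 <= INR m * h n) by nra. assert (0 <= INR m' * h n) by nra.
  repeat split.
  - eapply Rle_trans; [apply L|]. apply Rmult_le_compat_l; lra.
  - eapply Rle_trans; [apply L|]. apply Rmult_le_compat_l; lra.
  - lra.
  - lra. }
split.
- intros t0 Ht0. apply is_derive_of_secant. intros eta He.
  destruct (Hf t0 (s t0) (mkposreal eta He)) as [[d Hd] Hfd]. simpl in Hfd.
  (* With [|t - t0| < r] and a mesh below [r], the grid points between [t0] and [t] lie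
     within [2 r <= d] of [t0], and the values there within
     [2 M r + d / 4 < d] of [s t0]. *)
  set (r := Rmin t0 (Rmin (d / 2) (d / (4 * (M + 1))))).
  assert (Hq : 0 < d / (4 * (M + 1))) by (apply Rdiv_lt_0_compat; lra).
  assert (Hr : 0 < r) by (unfold r; repeat apply Rmin_case; lra).
  assert (Hr1 : r <= t0) by apply Rmin_l.
  assert (Hr2 : r <= d / 2)
    by (eapply Rle_trans; [apply Rmin_r | apply Rmin_l]).
  assert (Hr3 : M * r <= d / 4).
  { assert (r <= d / (4 * (M + 1)))
      by (eapply Rle_trans; [apply Rmin_r | apply Rmin_r]).
    apply Rle_trans with ((M + 1) * (d / (4 * (M + 1)))).
    - apply Rmult_le_compat; lra.
    - right. field. lra. }
  exists r. split; [exact Hr|].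
  assert (Hloc : forall t1 t2, 0 <= t1 <= t2 -> t2 - t1 < r -> t1 <= t0 <= t2 ->
    (t1 = t0 \/ t2 = t0) ->
    Rabs (s t2 - s t1 - f t0 (s t0) * (t2 - t1)) <= eta * (t2 - t1)).
  { intros t1 t2 Ht Htr Ht0' Heq. apply Hpass; [exact Ht | lra |].
    generalize (filter_and _ _ (Hsmall r Hr)
      (filterlim_Rabs_lt U FU _ _ (d / 4) (Hs t0 ltac:(lra)) ltac:(lra))).
    apply filter_imp. intros n [Hn1 Hn2] j Hj.
    destruct (Hlip n t1 t2 Ht j ltac:(lia)) as [H1 [H2 H3]].
    assert (HMh : M * (t2 - t1 + h n) <= M * (2 * r))
      by (apply Rmult_le_compat_l; lra).
    left. apply Hfd.
    - apply Rabs_lt_between. assert (Hn := Hh n). lra.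
    - apply Rabs_le_between in H1, H2. apply Rabs_lt_between in Hn2.
      apply Rabs_lt_between. destruct Heq as [-> | ->]; lra. }
  intros t Ht. destruct (Rle_dec t0 t) as [H | H].
  + rewrite (Rabs_right (t - t0)) in * by lra. apply Hloc; auto with real; lra.
  + rewrite (Rabs_left (t - t0)) in * by lra.
    assert (H' := Hloc t t0 ltac:(lra) ltac:(lra) ltac:(lra) ltac:(auto)).
    rewrite <- Rabs_Ropp. replace (- (t - t0)) with (t0 - t) by ring.
    replace (- _) with (s t0 - s t - f t0 (s t0) * (t0 - t)) by ring. exact H'.
- intros t1 t2 Ht.
  assert (H := Hpass t1 t2 0 M Ht M0). rewrite Rmult_0_l, Rminus_0_r in H.
  apply H. apply filter_forall. intros n j _. rewrite Rminus_0_r. apply HM.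
Qed.

Lemma filterlim_ultra_le (U : (nat -> Prop) -> Prop) (FU : ProperFilter U)
  (u : nat -> R) (l m : R) :
  filterlim u U (locally l) -> U (fun n => u n <= m) -> l <= m.
Proof.
intros Hu Hm. apply Rle_plus_epsilon. intros e He.
assert (H := filterlim_Rabs_lt U FU u l e Hu He).
destruct (filter_ex _ (filter_and _ _ H Hm)) as [n [H1 H2]].
apply Rabs_lt_between in H1. lra.
Qed.

(** * Periodic solutions of scalar equations with continuous right-hand side *)

Definition mesh (T : R) (n : nat) : R := T / INR (S n).

Lemma mesh_pos (T : R) (n : nat) : 0 < T -> 0 < mesh T n.
Proof. intros HT. apply Rdiv_lt_0_compat; [exact HT | apply lt_0_INR; lia]. Qed.

Lemma mesh_total (T : R) (n : nat) : INR (S n) * mesh T n = T.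
Proof. unfold mesh. field. apply not_0_INR. lia. Qed.

Lemma mesh_lim (T : R) : is_lim_seq (mesh T) 0.
Proof.
replace (Finite 0) with (Rbar_mult T 0) by (simpl; f_equal; ring).
apply (is_lim_seq_scal_l (fun n => / INR (S n)) T 0).
apply (is_lim_seq_incr_1 (fun n => / INR n)).
replace (Finite 0) with (Rbar_inv p_infty) by reflexivity.
apply is_lim_seq_inv; [apply is_lim_seq_INR | discriminate].
Qed.

Lemma euler_limit_exists (U : (nat -> Prop) -> Prop) (HU : free_ultrafilter U)
  (f : R -> R -> R) (M T B : R) (c : nat -> R) :
  (forall t y, continuity_2d_pt f t y) -> (forall t y, Rabs (f t y) <= M) ->
  0 < T -> (forall n, Rabs (c n) <= B) ->
  exists s, solves_forward f M s /\
    forall t, 0 <= t -> filterlim (fun n => euler_step f (mesh T n) (c n) t) U (locally (s t)).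
Proof.
intros Hf HM HT Hc.
destruct (functional_choice (fun t l => 0 <= t ->
  filterlim (fun n => euler_step f (mesh T n) (c n) t) U (locally l))) as [s Hs].
- intros t. destruct (Rle_dec 0 t) as [Ht | Ht]; [| exists 0; intros H; contradiction].
  destruct (ultralimit_exists U HU (fun n => euler_step f (mesh T n) (c n) t) (B + M * t))
    as [l Hl]; [| now exists l].
  intros n. assert (Hm := mesh_pos T n HT).
  assert (Hi := step_index_spec (mesh T n) t Hm Ht). unfold euler_step.
  set (i := step_index (mesh T n) t) in *.
  assert (H := euler_secant f (mesh T n) (c n) 0 M 0 i ltac:(lra)).
  rewrite Rmult_0_l, Rminus_0_r in H. simpl Nat.add in H.
  assert (H' : Rabs (euler f (mesh T n) (c n) i - c n) <= M * (INR i * mesh T n)).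
  { apply H. intros j _. rewrite Rminus_0_r. apply HM. }
  assert (M * (INR i * mesh T n) <= M * t).
  { apply Rmult_le_compat_l; [| lra]. eapply Rle_trans; [apply Rabs_pos | apply (HM 0 0)]. }
  specialize (Hc n). apply Rabs_le_between in H', Hc. apply Rabs_le. lra.
- exists s. split; [| exact Hs].
  apply (euler_limit_solves U HU f M (mesh T) c s Hf HM); [| apply mesh_lim | exact Hs].
  intros n. now apply mesh_pos.
Qed.

Lemma euler_step_0 (f : R -> R -> R) (h c : R) : 0 < h -> euler_step f h c 0 = c.
Proof.
intros Hh. unfold euler_step. now rewrite (step_index_unique h 0 0); [| | simpl; lra].
Qed.

Lemma euler_step_period (f : R -> R -> R) (T c : R) (n : nat) : 0 < T ->
  euler_step f (mesh T n) c T = euler f (mesh T n) c (S n).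
Proof.
intros HT. unfold euler_step.
assert (Hm := mesh_pos T n HT). assert (H := mesh_total T n).
rewrite (step_index_unique (mesh T n) T (S n)); [reflexivity | exact Hm | lra].
Qed.

(** If the strict sign failed for ultrafilter-many meshes, the limit of these schemes
    would be a solution violating it. The sign is thus checked on solutions only,
    never on discrete schemes. *)
Lemma return_sign_persists (U : (nat -> Prop) -> Prop) (HU : free_ultrafilter U)
  (f : R -> R -> R) (M T sigma c : R) :
  (forall t y, continuity_2d_pt f t y) -> (forall t y, Rabs (f t y) <= M) -> 0 < T ->
  (forall s, solves_forward f M s -> s 0 = c -> 0 < sigma * (s T - c)) ->
  U (fun n => 0 < sigma * (euler f (mesh T n) c (S n) - c)).
Proof.
intros Hf HM HT Hsign. assert (FU := ultra_proper U HU).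
destruct (ultra_dichotomy U HU (fun n => 0 < sigma * (euler f (mesh T n) c (S n) - c)))
  as [H | H]; [exact H |]. exfalso.
destruct (euler_limit_exists U HU f M T (Rabs c) (fun _ => c) Hf HM HT) as [s [Hs Hlim]];
  [intros _; lra |].
assert (H0 : s 0 = c).
{ apply (filterlim_locally_unique (F := U) (fun n => euler_step f (mesh T n) c 0));
    [apply Hlim; lra |].
  apply (filterlim_ext (fun _ => c)); [| apply filterlim_const].
  intros n. symmetry. now apply euler_step_0, mesh_pos. }
assert (H1 := Hsign s Hs H0).
apply (Rlt_not_le _ _ H1).
apply (filterlim_ultra_le U FU (fun n => sigma * (euler_step f (mesh T n) c T - c))).
- apply (filterlim_comp _ _ _ (fun n => euler_step f (mesh T n) c T)
           (fun y => sigma * (y - c)) _ (locally (s T))).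
  + apply Hlim. lra.
  + apply (continuity_pt_filterlim (fun y => sigma * (y - c))). reg.
- revert H. apply filter_imp. intros n Hn. rewrite euler_step_period by exact HT. lra.
Qed.

(** The discrete return map is a composition of continuous functions, hence
    continuous, whereas the return map of the equation need not even be
    single-valued. The intermediate value theorem closes the schemes of
    ultrafilter-many meshes, and their limit is closed as well. *)
Lemma periodic_on_half_line (f : R -> R -> R) (M T sigma a b : R) :
  (forall t y, continuity_2d_pt f t y) -> (forall t y, Rabs (f t y) <= M) -> 0 < T ->
  (forall t y, f (t + T) y = f t y) -> a <= b ->
  (forall s, solves_forward f M s -> s 0 = a -> sigma * (s T - a) < 0) ->
  (forall s, solves_forward f M s -> s 0 = b -> 0 < sigma * (s T - b)) ->
  exists s, solves_forward f M s /\ a <= s 0 <= b /\ forall t, 0 <= t -> s (t + T) = s t.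
Proof.
intros Hf HM HT Hper Hab Ha Hb.
destruct free_ultrafilter_exists as [U HU]. assert (FU := ultra_proper U HU).
assert (Hna := return_sign_persists U HU f M T (- sigma) a Hf HM HT
  ltac:(intros s Hs H0; specialize (Ha s Hs H0); lra)).
assert (Hnb := return_sign_persists U HU f M T sigma b Hf HM HT Hb).
destruct (functional_choice (fun n c => a <= c <= b /\
  (0 < - sigma * (euler f (mesh T n) a (S n) - a) ->
   0 < sigma * (euler f (mesh T n) b (S n) - b) ->
   euler f (mesh T n) c (S n) = c))) as [c Hc].
{ intros n.
  destruct (Rlt_dec 0 (- sigma * (euler f (mesh T n) a (S n) - a))) as [H1 | H1];
    [| exists a; split; [lra | intros; contradiction]].
  destruct (Rlt_dec 0 (sigma * (euler f (mesh T n) b (S n) - b))) as [H2 | H2];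
    [| exists a; split; [lra | intros; contradiction]].
  destruct (IVT_cor (fun c => sigma * (euler f (mesh T n) c (S n) - c)) a b)
    as [c [Hc1 Hc2]].
  - intros y. apply continuity_pt_scal, continuity_pt_minus.
    + now apply euler_continuous.
    + apply derivable_continuous_pt, derivable_pt_id.
  - exact Hab.
  - nra.
  - exists c. split; [exact Hc1 |]. intros _ _.
    apply Rmult_integral in Hc2. destruct Hc2 as [-> | Hc2]; [lra | lra]. }
destruct (euler_limit_exists U HU f M T (Rabs a + Rabs b) c Hf HM HT) as [s [Hs Hlim]].
{ intros n. destruct (Hc n) as [Hn _].
  assert (H1 := Rle_abs b). assert (H2 := Rle_abs (- a)). rewrite Rabs_Ropp in H2.
  assert (H3 := Rabs_pos a). assert (H4 := Rabs_pos b). apply Rabs_le. lra. }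
exists s. split; [exact Hs |].
assert (Hl0 : filterlim c U (locally (s 0))).
{ apply (filterlim_ext (fun n => euler_step f (mesh T n) (c n) 0)); [| apply Hlim; lra].
  intros n. now apply euler_step_0, mesh_pos. }
split; [split |].
- apply Ropp_le_cancel.
  apply (filterlim_ultra_le U FU (fun n => - c n)).
  + apply (filterlim_comp _ _ _ c Ropp _ _ _ Hl0).
    apply (continuity_pt_filterlim Ropp). reg.
  + apply filter_forall. intros n. destruct (Hc n). lra.
- apply (filterlim_ultra_le U FU c); [exact Hl0 |].
  apply filter_forall. intros n. destruct (Hc n). lra.
- intros t Ht.
  apply (filterlim_locally_unique (F := U) (fun n => euler_step f (mesh T n) (c n) (t + T)));
    [apply Hlim; lra |].
  generalize (Hlim t Ht). apply filterlim_ext_loc.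
  generalize (filter_and _ _ Hna Hnb). apply filter_imp. intros n [Hn1 Hn2].
  destruct (Hc n) as [_ Hcn]. specialize (Hcn Hn1 Hn2).
  assert (Hm := mesh_pos T n HT). unfold euler_step.
  replace (t + T) with (t + INR (S n) * mesh T n) by now rewrite mesh_total.
  rewrite step_index_shift by assumption.
  symmetry. apply (euler_periodic f (mesh T n) (c n) T (S n)); auto using mesh_total.
Qed.

Lemma period_multiples (T : R) (s : R -> R) : 0 < T ->
  (forall t, 0 <= t -> s (t + T) = s t) ->
  forall m t, 0 <= t -> s (t + INR m * T) = s t.
Proof.
intros HT Hper. induction m as [| m IH]; intros t Ht.
- simpl INR. f_equal. ring.
- rewrite S_INR. replace (t + (INR m + 1) * T) with ((t + INR m * T) + T) by ring.
  rewrite Hper; [now apply IH |]. assert (H := pos_INR m). nra.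
Qed.

(** The factor [sigma] covers at once an interval that the return map stretches
    ([sigma > 0]) and one that it contracts ([sigma < 0]). Periodicity extends the
    solution from the half-line to negative times. *)
Theorem periodic_solution_between (f : R -> R -> R) (M T sigma a b : R) :
  (forall t y, continuity_2d_pt f t y) -> (forall t y, Rabs (f t y) <= M) -> 0 < T ->
  (forall t y, f (t + T) y = f t y) -> a <= b ->
  (forall s, solves_forward f M s -> s 0 = a -> sigma * (s T - a) < 0) ->
  (forall s, solves_forward f M s -> s 0 = b -> 0 < sigma * (s T - b)) ->
  exists s c, a <= c <= b /\ (forall t, is_derive s t (f t (s t))) /\
    (forall t, s (t + T) = s t) /\ (forall t, Rabs (s t - c) <= M * T).
Proof.
intros Hf HM HT Hper Hab Ha Hb.
destruct (periodic_on_half_line f M T sigma a b Hf HM HT Hper Hab Ha Hb)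
  as [s [[Hs Hlip] [H0 Hsper]]].
assert (M0 : 0 <= M) by (eapply Rle_trans; [apply Rabs_pos | apply (HM 0 0)]).
assert (Hmult := period_multiples T s HT Hsper).
(* [t - IZR (q t) * T] is the representative of [t] in the first period. *)
set (q := fun t => Int_part (t / T)).
assert (Hq : forall t, 0 <= t - IZR (q t) * T < T).
{ intros t. unfold q. destruct (base_Int_part (t / T)) as [H1 H2].
  assert (Ht : t = t / T * T) by (field; lra). split; nra. }
set (s_ext t := s (t - IZR (q t) * T)).
assert (HS : forall m t, 0 <= t + INR m * T -> s_ext t = s (t + INR m * T)).
{ intros m t Ht. assert (Hqt := Hq t).
  assert (Hz : (0 <= q t + Z.of_nat m)%Z).
  { enough (-1 < q t + Z.of_nat m)%Z by lia. apply lt_IZR.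
    rewrite plus_IZR, <- INR_IZR_INZ. nra. }
  unfold s_ext. rewrite <- (Hmult (Z.to_nat (q t + Z.of_nat m)) (t - IZR (q t) * T)) by lra.
  f_equal. rewrite INR_IZR_INZ, Z2Nat.id, plus_IZR, <- INR_IZR_INZ by exact Hz. ring. }
assert (Hf_mult : forall m t y, f (t + INR m * T) y = f t y).
{ induction m as [| m IH]; intros t y.
  - simpl INR. f_equal. ring.
  - rewrite S_INR. replace (t + (INR m + 1) * T) with ((t + INR m * T) + T) by ring.
    now rewrite Hper. }
exists s_ext, (s 0). split; [exact H0 |]. split; [| split].
- intros t0.
  destruct (INR_unbounded (- t0 / T)) as [m Hm].
  assert (Hm0 : 0 < t0 + INR m * T).
  { assert (Ht : - t0 = - t0 / T * T) by (field; lra). nra. }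
  apply (is_derive_ext_loc (fun t => s (t + INR m * T))).
  + exists (mkposreal _ Hm0). intros t Ht. simpl in Ht.
    apply Rabs_lt_between' in Ht. symmetry. apply HS. simpl in Ht. lra.
  + rewrite (HS m t0) by lra. rewrite <- (Hf_mult m t0).
    replace (f _ _) with (scal 1 (f (t0 + INR m * T) (s (t0 + INR m * T))))
      by exact (Rmult_1_l _).
    apply (is_derive_comp s (fun t => t + INR m * T)); [now apply Hs |].
    auto_derive; [exact I | ring].
- intros t.
  destruct (INR_unbounded (- t / T)) as [m Hm].
  assert (Hm0 : 0 < t + INR m * T).
  { assert (Ht : - t = - t / T * T) by (field; lra). nra. }
  rewrite (HS m (t + T)), (HS m t) by lra.
  replace (t + T + INR m * T) with (t + INR m * T + T) by ring. apply Hsper. lra.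
- intros t. assert (Hqt := Hq t). unfold s_ext.
  assert (H := Hlip 0 (t - IZR (q t) * T) ltac:(lra)).
  eapply Rle_trans; [exact H |]. apply Rmult_le_compat_l; lra.
Qed.

(** * One-dimensional autonomous flows *)

(** Separation of variables: [theta] is the inverse of the time function, the integral
    of [/ G], and [P] is the time that [theta] takes to travel the length [T]. *)
Lemma autonomous_flow (G : R -> R) (T : R) :
  0 < T -> (forall u, continuous G u) -> (forall u, 1 / 2 <= G u <= 2) ->
  (forall u, G (u + T) = G u) ->
  exists (theta : R -> R) (P : R), 0 < P /\
    (forall t, is_derive theta t (G (theta t))) /\
    (forall t, theta (t + P) = theta t + T) /\
    (forall u, exists t, theta t = u).
Proof.
intros HT HG Hb Hper.
set (tau u := RInt (fun z => / G z) 0 u).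
assert (Hinv : forall u, continuous (fun z => / G z) u).
{ intros u. apply (continuous_comp G Rinv); [apply HG |].
  apply continuity_pt_filterlim, continuity_pt_inv; [reg | specialize (Hb u); lra]. }
assert (Hex : forall u v, ex_RInt (fun z => / G z) u v)
  by (intros u v; apply (ex_RInt_continuous (V := R_CompleteNormedModule)); intros z _; apply Hinv).
assert (Hd : forall u, is_derive tau u (/ G u)).
{ intros u. apply (is_derive_RInt (fun z => / G z) tau 0 u); [| apply Hinv].
  apply filter_forall. intros v. apply (RInt_correct (V := R_CompleteNormedModule)), Hex. }
assert (Hinc : forall u v, exists z, Rmin u v <= z <= Rmax u v /\
  (v - u) = G z * (tau v - tau u)).
{ intros u v. destruct (MVT_gen tau u v (fun z => / G z)) as [z [Hz1 Hz2]].
  - intros z _. apply Hd.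
  - intros z _. apply continuity_pt_filterlim, (ex_derive_continuous tau).
    eexists. apply Hd.
  - exists z. split; [exact Hz1 |]. rewrite Hz2. specialize (Hb z). field. lra. }
assert (Hshift : forall u, tau (u + T) = tau u + tau T).
{ intros u. unfold tau. rewrite <- (RInt_Chasles _ 0 T (u + T)) by apply Hex.
  unfold plus; simpl. rewrite Rplus_comm. f_equal.
  replace T with (1 * 0 + T) at 1 by ring. replace (u + T) with (1 * u + T) by ring.
  rewrite <- (RInt_comp_lin (fun z => / G z) 1 T 0 u) by apply Hex.
  apply RInt_ext. intros z _. unfold scal; simpl; unfold mult; simpl.
  now rewrite !Rmult_1_l, Hper. }
assert (H0 : tau 0 = 0) by apply (RInt_point 0 (fun z => / G z)).
assert (Hsurj : forall t, exists u, tau u = t).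
{ intros t. destruct (IVT_gen tau (- (2 * Rabs t)) (2 * Rabs t) t) as [u [_ Hu]].
  - intros u. apply continuity_pt_filterlim, (ex_derive_continuous tau).
    eexists. apply Hd.
  - assert (Ht := Rabs_pos t).
    destruct (Hinc 0 (2 * Rabs t)) as [z1 [_ Hz1]].
    destruct (Hinc 0 (- (2 * Rabs t))) as [z2 [_ Hz2]].
    assert (Hb1 := Hb z1). assert (Hb2 := Hb z2). rewrite H0, Rminus_0_r in *.
    assert (H1 : Rabs t <= tau (2 * Rabs t)) by (rewrite Rminus_0_r in Hz1; nra).
    assert (H2 : tau (- (2 * Rabs t)) <= - Rabs t) by (rewrite Rminus_0_r in Hz2; nra).
    assert (H3 := proj1 (Rabs_le_between t (Rabs t)) (Rle_refl _)).
    rewrite Rmin_left, Rmax_right by lra. lra.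
  - now exists u. }
destruct (functional_choice (fun t u => tau u = t) Hsurj) as [theta Htheta].
assert (Hinj : forall u v, tau u = tau v -> u = v).
{ intros u v H. destruct (Hinc u v) as [z [_ Hz]]. rewrite H in Hz. lra. }
exists theta, (tau T). split; [| split; [| split]].
- destruct (Hinc 0 T) as [z [_ Hz]]. rewrite H0 in Hz. specialize (Hb z). nra.
- intros t0. apply is_derive_of_secant. intros eta He.
  destruct (proj1 (filterlim_locally G _) (HG (theta t0)) (mkposreal eta He)) as [d Hd'].
  assert (Hd0 := cond_pos d).
  exists (d / 2). split; [lra |]. intros t Ht.
  destruct (Hinc (theta t0) (theta t)) as [z [Hz1 Hz2]].
  rewrite !Htheta in Hz2. rewrite Hz2.
  replace (_ - _) with ((G z - G (theta t0)) * (t - t0)) by ring.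
  rewrite Rabs_mult. apply Rmult_le_compat_r; [apply Rabs_pos |].
  left. apply (Hd' z). apply Rabs_lt_between'.
  assert (Hbz := Hb z).
  apply Rabs_lt_between in Ht.
  unfold Rmin, Rmax in Hz1. destruct (Rle_dec _ _); nra.
- intros t. apply Hinj. now rewrite Hshift, !Htheta.
- intros u. exists (tau u). apply Hinj. now rewrite Htheta.
Qed.

(** * Regularity of the right-hand side *)

Lemma cbrt_le (u w : R) : u <= w -> cbrt u <= cbrt w.
Proof.
intros H. apply Rnot_lt_le. intros Hlt.
rewrite <- (cbrt_pow3 u), <- (cbrt_pow3 w) in H.
revert H Hlt. generalize (cbrt u) (cbrt w). intros a b H Hlt.
assert (Hsq : 0 < (a - b) ^ 2) by (apply pow_lt; lra).
assert (Hpos : 0 < (a - b) * (a ^ 2 + a * b + b ^ 2))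
  by (apply Rmult_lt_0_compat; nra).
replace ((a - b) * (a ^ 2 + a * b + b ^ 2)) with (a ^ 3 - b ^ 3) in Hpos by ring. lra.
Qed.

Lemma cbrt_of_cube (c : R) : cbrt (c ^ 3) = c.
Proof.
assert (H := cbrt_pow3 (c ^ 3)). set (d := cbrt (c ^ 3)) in *.
destruct (Req_dec d c) as [Hd | Hd]; [exact Hd | exfalso].
assert (Hsq : 0 < (d - c) ^ 2) by (apply pow2_gt_0; lra).
assert (Hpos : 0 < d ^ 2 + d * c + c ^ 2) by nra.
assert (H' : (d - c) * (d ^ 2 + d * c + c ^ 2) = 0) by (ring_simplify; lra).
apply Rmult_integral in H'. lra.
Qed.

Lemma pow3_lt (a b : R) : a < b -> a ^ 3 < b ^ 3.
Proof.
intros H. apply Rnot_le_lt. intros Hle. apply cbrt_le in Hle.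
rewrite !cbrt_of_cube in Hle. lra.
Qed.

(** The strict monotonicity of the cube squeezes [cbrt] between two cube roots that
    are known exactly. *)
Lemma cbrt_continuous (u : R) : continuous cbrt u.
Proof.
apply filterlim_locally. intros eta. assert (He := cond_pos eta).
set (c := cbrt u).
assert (Hc : c ^ 3 = u) by apply cbrt_pow3.
assert (Hlo : (c - eta / 2) ^ 3 < u) by (rewrite <- Hc; apply pow3_lt; lra).
assert (Hhi : u < (c + eta / 2) ^ 3) by (rewrite <- Hc; apply pow3_lt; lra).
assert (Hd : 0 < Rmin (u - (c - eta / 2) ^ 3) ((c + eta / 2) ^ 3 - u))
  by (apply Rmin_case; lra).
exists (mkposreal _ Hd). intros w Hw. cbn [pos] in Hw. apply Rabs_lt_between' in Hw.
assert (H1 := Rmin_l (u - (c - eta / 2) ^ 3) ((c + eta / 2) ^ 3 - u)).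
assert (H2 := Rmin_r (u - (c - eta / 2) ^ 3) ((c + eta / 2) ^ 3 - u)).
assert (H3 := cbrt_le ((c - eta / 2) ^ 3) w ltac:(lra)).
assert (H4 := cbrt_le w ((c + eta / 2) ^ 3) ltac:(lra)).
rewrite cbrt_of_cube in H3, H4.
apply Rabs_lt_between'. lra.
Qed.

(** Otherwise points with unbounded values would have an ultralimit in the box, where
    continuity of [E] bounds the values again. *)
Lemma continuous_bounded_on_box (E : R * R * R -> R) (B : R) :
  (forall p, continuous E p) ->
  exists M, 0 <= M /\ forall x y z, Rabs x <= B -> Rabs y <= B -> Rabs z <= B ->
    Rabs (E (x, y, z)) <= M.
Proof.
intros HE. apply NNPP. intros Hno.
destruct (functional_choice (fun (n : nat) (p : R * R * R) =>
  (Rabs (fst (fst p)) <= B /\ Rabs (snd (fst p)) <= B /\ Rabs (snd p) <= B) /\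
  INR n < Rabs (E p))) as [p Hp].
{ intros n. apply NNPP. intros Hn. apply Hno. exists (INR n).
  split; [apply pos_INR |]. intros x y z Hx Hy Hz. apply Rnot_lt_le. intros H.
  apply Hn. now exists (x, y, z). }
destruct free_ultrafilter_exists as [U HU]. assert (FU := ultra_proper U HU).
destruct (ultralimit_exists U HU (fun n => fst (fst (p n))) B) as [x Hx];
  [intros n; apply Hp |].
destruct (ultralimit_exists U HU (fun n => snd (fst (p n))) B) as [y Hy];
  [intros n; apply Hp |].
destruct (ultralimit_exists U HU (fun n => snd (p n)) B) as [z Hz];
  [intros n; apply Hp |].
assert (Hlim : filterlim (fun n => E (p n)) U (locally (E (x, y, z)))).
{ apply (filterlim_comp _ _ _ p E U (locally (x, y, z))); [| apply HE].
  apply filterlim_locally. intros eta.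
  assert (H1 := proj1 (filterlim_locally _ _) Hx eta).
  assert (H2 := proj1 (filterlim_locally _ _) Hy eta).
  assert (H3 := proj1 (filterlim_locally _ _) Hz eta).
  generalize (filter_and _ _ H1 (filter_and _ _ H2 H3)). apply filter_imp.
  intros n [G1 [G2 G3]]. repeat split; assumption. }
assert (H1 := filterlim_Rabs_lt U FU _ _ 1 Hlim Rlt_0_1).
destruct (INR_unbounded (Rabs (E (x, y, z)) + 1)) as [N HN].
destruct (filter_ex _ (filter_and _ _ H1 (ultra_free U HU N))) as [n [Hn1 Hn2]].
destruct (Hp n) as [_ Hn]. apply le_INR in Hn2.
assert (H := Rabs_triang_inv (E (p n)) (E (x, y, z))). lra.
Qed.

Lemma rhs_continuous (Z : UniformSpace) (k : nat) (E : R * R * R -> R) (eps : R)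
  (X V : Z -> R) (z : Z) :
  (forall p, continuous E p) -> continuous X z -> continuous V z ->
  continuous (fun z => rhs k E eps (X z) (V z)) z.
Proof.
intros HE HX HV.
assert (Hsq : forall Y : Z -> R, continuous Y z -> continuous (fun z => Y z ^ 2) z).
{ intros Y HY. apply (continuous_comp Y (fun y => y ^ 2)); [exact HY |].
  apply continuity_pt_filterlim. reg. }
assert (Hrho : continuous (fun z => X z ^ 2 + V z ^ 2) z).
{ apply (continuous_plus (fun z => X z ^ 2) (fun z => V z ^ 2)); now apply Hsq. }
unfold rhs.
apply (continuous_plus (fun z => - X z + eps * (X z ^ 2 + V z ^ 2) +
  eps ^ k * V z * cbrt (X z ^ 2 + V z ^ 2 - 1)) (fun z => eps ^ (k + 1) * E (X z, V z, eps))).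
- apply (continuous_plus (fun z => - X z + eps * (X z ^ 2 + V z ^ 2))
    (fun z => eps ^ k * V z * cbrt (X z ^ 2 + V z ^ 2 - 1))).
  + apply (continuous_plus (fun z => - X z) (fun z => eps * (X z ^ 2 + V z ^ 2))).
    * now apply (continuous_opp X).
    * now apply (continuous_scal_r eps (fun z => X z ^ 2 + V z ^ 2)).
  + apply (continuous_mult (fun z => eps ^ k * V z)).
    * now apply (continuous_scal_r (eps ^ k) V).
    * apply (continuous_comp (fun z => X z ^ 2 + V z ^ 2 - 1) cbrt);
        [| apply cbrt_continuous].
      apply (continuous_minus (fun z => X z ^ 2 + V z ^ 2) (fun _ => 1));
        [exact Hrho | apply continuous_const].
- apply (continuous_scal_r (eps ^ (k + 1)) (fun z => E (X z, V z, eps))).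
  apply (continuous_comp (fun z => (X z, V z, eps)) E); [| apply HE].
  apply filterlim_locally. intros eta.
  assert (H1 := proj1 (filterlim_locally _ _) HX eta).
  assert (H2 := proj1 (filterlim_locally _ _) HV eta).
  generalize (filter_and _ _ H1 H2). apply filter_imp. intros z' [G1 G2].
  repeat split; [exact G1 | exact G2 | apply ball_center].
Qed.

(** * The equation in polar coordinates *)

(** In the coordinates [x = exp s * cos th], [v = - exp s * sin th] (clockwise, the
    direction of the flow), this is the perturbation of the oscillator
    [x'' = - x]. *)
Definition polar_force (k : nat) (E : R * R * R -> R) (eps th s : R) : R :=
  rhs k E eps (exp s * cos th) (- (exp s * sin th)) + exp s * cos th.

Definition angular_speed (k : nat) (E : R * R * R -> R) (eps th s : R) : R :=
  1 - exp (- s) * polar_force k E eps th s * cos th.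

(** The system reads [s' = - exp (- s) * polar_force * sin th] and
    [th' = angular_speed]; their quotient is [ds/dth]. *)
Definition radial_slope (k : nat) (E : R * R * R -> R) (eps th s : R) : R :=
  - (exp (- s) * polar_force k E eps th s * sin th) / angular_speed k E eps th s.

Lemma cos_sin_sq (th : R) : cos th ^ 2 = 1 - sin th ^ 2.
Proof. assert (H := sin2_cos2 th). unfold Rsqr in H. lra. Qed.

Lemma polar_force_eq (k : nat) (E : R * R * R -> R) (eps th s : R) :
  polar_force k E eps th s =
    eps * exp s ^ 2 - eps ^ k * exp s * sin th * cbrt (exp s ^ 2 - 1)
    + eps ^ (k + 1) * E (exp s * cos th, - (exp s * sin th), eps).
Proof.
unfold polar_force, rhs.
replace ((exp s * cos th) ^ 2 + (- (exp s * sin th)) ^ 2) with (exp s ^ 2).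
- ring.
- replace ((- (exp s * sin th)) ^ 2) with (exp s ^ 2 * sin th ^ 2) by ring.
  rewrite Rpow_mult_distr, cos_sin_sq. ring.
Qed.

Lemma exp_half_bounds (s : R) : Rabs s <= 1 / 2 -> 1 / 2 <= exp s <= 2.
Proof.
intros H. apply Rabs_le_between in H.
assert (H1 := exp_ineq1_le s). assert (H2 := exp_ineq1_le (- s)).
rewrite exp_Ropp in H2. assert (Hp := exp_pos s).
split; [lra |].
assert (H3 : / exp s * exp s = 1) by (field; lra). nra.
Qed.

Lemma pow_abs_le (eps : R) (m : nat) : (0 < m)%nat -> Rabs eps <= 1 ->
  Rabs (eps ^ m) <= Rabs eps.
Proof.
intros Hm He. rewrite <- RPow_abs. destruct m as [| m]; [lia |]. simpl.
rewrite <- (Rmult_1_r (Rabs eps)) at 3.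
apply Rmult_le_compat_l; [apply Rabs_pos |].
rewrite <- (pow1 m). apply pow_incr. split; [apply Rabs_pos | exact He].
Qed.

Lemma Rabs_mult_le (a b A B : R) : Rabs a <= A -> Rabs b <= B -> Rabs (a * b) <= A * B.
Proof.
intros Ha Hb. rewrite Rabs_mult. apply Rmult_le_compat; auto using Rabs_pos.
Qed.

Lemma Rabs_cos_le (th : R) : Rabs (cos th) <= 1.
Proof. apply Rabs_le. apply COS_bound. Qed.

Lemma Rabs_sin_le (th : R) : Rabs (sin th) <= 1.
Proof. apply Rabs_le. apply SIN_bound. Qed.

Lemma perturbation_bound (E : R * R * R -> R) (M eps th s : R) :
  (forall x y z, Rabs x <= 2 -> Rabs y <= 2 -> Rabs z <= 2 -> Rabs (E (x, y, z)) <= M) ->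
  Rabs eps <= 1 -> Rabs s <= 1 / 2 ->
  Rabs (E (exp s * cos th, - (exp s * sin th), eps)) <= M.
Proof.
intros HM He Hs. assert (Hx := exp_half_bounds s Hs).
assert (Hx' : Rabs (exp s) <= 2) by (rewrite Rabs_right; lra).
apply HM; [| rewrite Rabs_Ropp | lra].
- replace 2 with (2 * 1) by ring. apply Rabs_mult_le; [exact Hx' | apply Rabs_cos_le].
- replace 2 with (2 * 1) by ring. apply Rabs_mult_le; [exact Hx' | apply Rabs_sin_le].
Qed.

Lemma polar_force_bound (k : nat) (E : R * R * R -> R) (M eps th s : R) :
  (forall x y z, Rabs x <= 2 -> Rabs y <= 2 -> Rabs z <= 2 -> Rabs (E (x, y, z)) <= M) ->
  (0 < k)%nat -> Rabs eps <= 1 -> Rabs s <= 1 / 2 ->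
  Rabs (polar_force k E eps th s) <= (8 + M) * Rabs eps.
Proof.
intros HM Hk He Hs. rewrite polar_force_eq.
assert (Hx := exp_half_bounds s Hs).
assert (H1 : Rabs (eps * exp s ^ 2) <= Rabs eps * 4).
{ apply Rabs_mult_le; [lra |]. rewrite Rabs_right; nra. }
assert (H2 : Rabs (eps ^ k * exp s * sin th * cbrt (exp s ^ 2 - 1)) <= Rabs eps * 2 * 1 * 2).
{ repeat apply Rabs_mult_le.
  - now apply pow_abs_le.
  - rewrite Rabs_right; lra.
  - apply Rabs_sin_le.
  - apply Rabs_le. rewrite <- (cbrt_of_cube 2) at 2. rewrite <- (cbrt_of_cube (- (2))).
    split; apply cbrt_le; nra. }
assert (H3 : Rabs (eps ^ (k + 1) * E (exp s * cos th, - (exp s * sin th), eps))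
             <= Rabs eps * M).
{ apply Rabs_mult_le; [apply pow_abs_le; [lia | exact He] |].
  now apply perturbation_bound. }
eapply Rle_trans; [apply Rabs_triang |].
eapply Rle_trans; [apply Rplus_le_compat_r, Rabs_triang |].
rewrite Rabs_Ropp. lra.
Qed.

Lemma polar_field_bounds (k : nat) (E : R * R * R -> R) (M eps th s : R) :
  (forall x y z, Rabs x <= 2 -> Rabs y <= 2 -> Rabs z <= 2 -> Rabs (E (x, y, z)) <= M) ->
  (0 < k)%nat -> 0 <= M -> (8 + M) * Rabs eps <= 1 / 4 -> Rabs s <= 1 / 2 ->
  1 / 2 <= angular_speed k E eps th s <= 3 / 2 /\
  Rabs (radial_slope k E eps th s) <= 4 * (8 + M) * Rabs eps.
Proof.
intros HM Hk M0 He Hs. assert (He0 := Rabs_pos eps).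
assert (He1 : Rabs eps <= 1) by nra.
assert (HF := polar_force_bound k E M eps th s HM Hk He1 Hs).
assert (Hx : 1 / 2 <= exp (- s) <= 2)
  by (apply exp_half_bounds; now rewrite Rabs_Ropp).
assert (HxF : Rabs (exp (- s) * polar_force k E eps th s) <= 2 * ((8 + M) * Rabs eps)).
{ apply Rabs_mult_le; [rewrite Rabs_right; lra | exact HF]. }
assert (Hc : Rabs (exp (- s) * polar_force k E eps th s * cos th)
             <= 2 * ((8 + M) * Rabs eps) * 1)
  by (apply Rabs_mult_le; [exact HxF | apply Rabs_cos_le]).
assert (Hsn : Rabs (exp (- s) * polar_force k E eps th s * sin th)
             <= 2 * ((8 + M) * Rabs eps) * 1)
  by (apply Rabs_mult_le; [exact HxF | apply Rabs_sin_le]).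
assert (HD : 1 / 2 <= angular_speed k E eps th s <= 3 / 2).
{ unfold angular_speed. apply Rabs_le_between in Hc. lra. }
split; [exact HD |].
unfold radial_slope, Rdiv.
replace (4 * (8 + M) * Rabs eps) with (2 * ((8 + M) * Rabs eps) * 1 * 2) by ring.
apply Rabs_mult_le; [now rewrite Rabs_Ropp |].
rewrite Rabs_right by (left; apply Rinv_0_lt_compat; lra).
rewrite <- (Rinv_inv 2). apply Rinv_le_contravar; lra.
Qed.

(** * Displacement after one turn *)

(** For [E = 0] and without the cube root term the function
    [exp (-2 eps x) * (x^2 + v^2)] is constant along solutions: the squared radius
    [rho] satisfies [rho' = 2 eps v rho] and [x' = v]. Half of its logarithm is
    differentiated here, so the term of order [eps] cancels exactly and only the
    terms in [eps ^ k] and [eps ^ (k + 1)] remain. *)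
Lemma first_integral_derive (k : nat) (E : R * R * R -> R) (eps th : R) (s : R -> R) :
  angular_speed k E eps th (s th) <> 0 ->
  is_derive s th (radial_slope k E eps th (s th)) ->
  is_derive (fun th => s th - eps * exp (s th) * cos th) th
    (eps ^ k * (sin th ^ 2 * cbrt (exp (s th) ^ 2 - 1)
       - eps * exp (- s th) * sin th * E (exp (s th) * cos th, - (exp (s th) * sin th), eps))
     / angular_speed k E eps th (s th)).
Proof.
intros HD Hs. auto_derive.
- assert (Hex : ex_derive (fun x : R => s x) th) by (eexists; exact Hs). tauto.
- assert (HDs : Derive (fun x : R => s x) th = radial_slope k E eps th (s th))
    by (apply is_derive_unique; exact Hs).
  rewrite HDs. clear HDs. unfold radial_slope.
  assert (HDe : angular_speed k E eps th (s th) =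
    1 - exp (- s th) * polar_force k E eps th (s th) * cos th) by reflexivity.
  set (D := angular_speed k E eps th (s th)) in *.
  assert (HF := polar_force_eq k E eps th (s th)).
  rewrite (exp_Ropp (s th)) in *. assert (Hx := exp_pos (s th)).
  set (e := E _) in *. set (c := cbrt _) in *.
  set (F := polar_force k E eps th (s th)) in *.
  set (x := exp (s th)) in *.
  apply (Rmult_eq_reg_r D); [| exact HD].
  transitivity (sin th * (eps * x - / x * F)).
  + transitivity (- (/ x * F * sin th) * (1 - eps * x * cos th) + D * (eps * x * sin th)).
    * field. split; [lra | exact HD].
    * rewrite HDe. field. lra.
  + rewrite HF, pow_add. field. split; [lra | exact HD].
Qed.

(** The derivative of the first integral, multiplied by [tau / eps ^ k], is at least
    [(2/3) q sin^2 - 4 M |eps|], because the angular speed lies between [1/2] and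
    [3/2]. Over a full turn this integrates to [(2/3) PI (q - 12 M |eps|) > 0]. At
    angle [0] the first integral is [s - eps * exp s], which increases with [s], so
    [s] moves in the same direction. *)
Lemma return_displacement (k : nat) (E : R * R * R -> R) (M eps tau q : R) (s : R -> R) :
  (forall x y z, Rabs x <= 2 -> Rabs y <= 2 -> Rabs z <= 2 -> Rabs (E (x, y, z)) <= M) ->
  (0 < k)%nat -> 0 <= M -> eps <> 0 -> (8 + M) * Rabs eps <= 1 / 4 -> Rabs tau <= 1 ->
  12 * M * Rabs eps < q ->
  (forall t, 0 <= t <= 2 * PI ->
     Rabs (s t) <= 1 / 2 /\ q <= tau * cbrt (exp (s t) ^ 2 - 1)) ->
  (forall t, 0 < t < 2 * PI -> is_derive s t (radial_slope k E eps t (s t))) ->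
  (forall t, 0 <= t <= 2 * PI -> continuity_pt s t) ->
  0 < tau * eps ^ k * (s (2 * PI) - s 0).
Proof.
intros HM Hk M0 He0 He Htau Hq Hs Hder Hcont.
assert (HPI := PI_RGT_0). assert (Hea := Rabs_pos_lt eps He0).
assert (He1 : Rabs eps <= 1 / 32) by nra.
assert (Hek : eps ^ k <> 0) by now apply pow_nonzero.
set (w := fun t => s t - eps * exp (s t) * cos t).
set (N := fun t => sin t ^ 2 * cbrt (exp (s t) ^ 2 - 1)
       - eps * exp (- s t) * sin t * E (exp (s t) * cos t, - (exp (s t) * sin t), eps)).
set (D := fun t => angular_speed k E eps t (s t)).
assert (Hw : forall t, 0 < t < 2 * PI -> is_derive w t (eps ^ k * N t / D t)).
{ intros t Ht. apply (first_integral_derive k E eps t s); [| now apply Hder].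
  destruct (Hs t ltac:(lra)) as [Hst _].
  destruct (polar_field_bounds k E M eps t (s t) HM Hk M0 He Hst) as [H _]. lra. }
assert (Hlow : forall t, 0 <= t <= 2 * PI ->
  0 <= tau * (N t / D t) - 2 / 3 * q * sin t ^ 2 + 4 * M * Rabs eps).
{ intros t Ht. destruct (Hs t Ht) as [Hst Hqt].
  destruct (polar_field_bounds k E M eps t (s t) HM Hk M0 He Hst) as [HD _].
  fold (D t) in HD.
  assert (Hrest : Rabs (tau * (eps * exp (- s t) * sin t *
            E (exp (s t) * cos t, - (exp (s t) * sin t), eps))) <= 1 * (Rabs eps * 2 * 1 * M)).
  { assert (Hx : 1 / 2 <= exp (- s t) <= 2)
      by (apply exp_half_bounds; now rewrite Rabs_Ropp).
    apply Rabs_mult_le; [exact Htau |]. repeat apply Rabs_mult_le.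
    - lra.
    - rewrite Rabs_right; lra.
    - apply Rabs_sin_le.
    - apply perturbation_bound; [exact HM | lra | exact Hst]. }
  apply Rabs_le_between in Hrest.
  assert (Hsq := pow2_ge_0 (sin t)).
  assert (Hq0 : 0 <= q) by nra.
  assert (HND : tau * N t >= sin t ^ 2 * q - 2 * M * Rabs eps).
  { unfold N. assert (sin t ^ 2 * q <= sin t ^ 2 * (tau * cbrt (exp (s t) ^ 2 - 1)))
      by now apply Rmult_le_compat_l.
    lra. }
  apply (Rmult_le_reg_r (D t)); [lra |].
  replace ((tau * (N t / D t) - 2 / 3 * q * sin t ^ 2 + 4 * M * Rabs eps) * D t)
    with (tau * N t - 2 / 3 * (q * sin t ^ 2) * D t + 4 * (M * Rabs eps) * D t)
    by (field; lra).
  assert (0 <= q * sin t ^ 2) by now apply Rmult_le_pos.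
  assert (0 <= M * Rabs eps) by (apply Rmult_le_pos; lra).
  nra. }
(* [(t - sin t * cos t) / 2] is the primitive of [sin t ^ 2]. *)
set (psi := fun t => tau / eps ^ k * w t
  - 2 / 3 * q * ((t - sin t * cos t) / 2) + 4 * M * Rabs eps * t).
destruct (MVT_gen psi 0 (2 * PI)
  (fun t => tau * (N t / D t) - 2 / 3 * q * sin t ^ 2 + 4 * M * Rabs eps))
  as [z [Hz1 Hz2]].
- rewrite Rmin_left, Rmax_right by lra. intros t Ht.
  assert (Hwt := Hw t Ht). unfold psi. revert Hwt. generalize w. intros w' Hwt.
  assert (Hex : ex_derive (fun x : R => w' x) t) by (eexists; exact Hwt).
  assert (HDw : Derive (fun x : R => w' x) t = eps ^ k * N t / D t)
    by (apply is_derive_unique; exact Hwt).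
  auto_derive; [tauto |]. rewrite HDw.
  assert (Hc := cos_sin_sq t).
  destruct (Hs t ltac:(lra)) as [Hst _].
  destruct (polar_field_bounds k E M eps t (s t) HM Hk M0 He Hst) as [HD _].
  fold (D t) in HD.
  replace (tau / eps ^ k * (1 * (eps ^ k * N t / D t))) with (tau * (N t / D t))
    by (field; lra).
  replace (1 + - (1 * cos t * cos t + sin t * (1 * - sin t))) with (2 * sin t ^ 2)
    by (ring_simplify; rewrite Hc; ring).
  field. lra.
- rewrite Rmin_left, Rmax_right by lra. intros t Ht.
  assert (Hct := Hcont t Ht).
  assert (Hexp : continuity_pt (fun t => exp (s t)) t)
    by (apply (continuity_pt_comp s exp); [exact Hct | reg]).
  unfold psi, w. reg.
- rewrite Rmin_left, Rmax_right in Hz1 by lra.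
  assert (Hpos : 0 <= psi (2 * PI) - psi 0).
  { rewrite Hz2. apply Rmult_le_pos; [now apply Hlow | lra]. }
  unfold psi in Hpos.
  rewrite sin_2PI, sin_0, cos_0, cos_2PI in Hpos.
  assert (Hgap : 0 < (q - 12 * M * Rabs eps) * PI) by (apply Rmult_lt_0_compat; lra).
  assert (Hwpos : 0 < tau / eps ^ k * (w (2 * PI) - w 0)) by lra.
  clear Hpos Hz2 Hz1.
  (* The mean value theorem turns the displacement of [w] into that of [s], up to
     the positive factor [1 - eps * exp xi]. *)
  destruct (MVT_gen exp (s 0) (s (2 * PI)) exp) as [xi [Hxi1 Hxi2]].
  + intros x _. apply is_derive_exp.
  + intros x _. reg.
  + destruct (Hs 0 ltac:(lra)) as [Ha _]. destruct (Hs (2 * PI) ltac:(lra)) as [Hb _].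
    assert (Hxi : Rabs xi <= 1 / 2).
    { apply Rabs_le_between in Ha, Hb. apply Rabs_le.
      unfold Rmin, Rmax in Hxi1. destruct (Rle_dec _ _); lra. }
    apply exp_half_bounds in Hxi.
    assert (Hkap : 0 < 1 - eps * exp xi).
    { assert (H := Rle_abs eps). assert (H' := Rabs_pos eps).
      assert (eps * exp xi <= Rabs eps * 2) by nra. lra. }
    unfold w in Hwpos. rewrite cos_0, cos_2PI in Hwpos.
    replace (s (2 * PI) - eps * exp (s (2 * PI)) * 1 - (s 0 - eps * exp (s 0) * 1))
      with ((s (2 * PI) - s 0) - eps * (exp (s (2 * PI)) - exp (s 0))) in Hwpos by ring.
    rewrite Hxi2 in Hwpos.
    apply (Rmult_lt_reg_r (1 - eps * exp xi)); [exact Hkap |].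
    rewrite Rmult_0_l.
    assert (Hsq : 0 < (eps ^ k) ^ 2) by now apply pow2_gt_0.
    assert (H := Rmult_lt_0_compat _ _ Hsq Hwpos).
    replace (tau * eps ^ k * (s (2 * PI) - s 0) * (1 - eps * exp xi))
      with ((eps ^ k) ^ 2 * (tau / eps ^ k * ((s (2 * PI) - s 0)
             - eps * (exp xi * (s (2 * PI) - s 0))))) by (field; exact Hek).
    exact H.
Qed.

Lemma cbrt_opp (u : R) : cbrt (- u) = - cbrt u.
Proof.
rewrite <- (cbrt_pow3 u) at 1. rewrite <- (cbrt_of_cube (- cbrt u)). f_equal. ring.
Qed.

Lemma exp_mul_le_1 (s : R) : exp s * (1 - s) <= 1.
Proof.
assert (H := exp_ineq1_le (- s)). rewrite exp_Ropp in H. assert (Hx := exp_pos s).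
apply (Rmult_le_compat_l (exp s)) in H; [| lra]. rewrite Rinv_r in H; lra.
Qed.

Lemma exp_sq_minus_one_bounds (s : R) : Rabs s <= 1 / 2 ->
  (0 <= s -> s <= exp s ^ 2 - 1) /\ (s <= 0 -> exp s ^ 2 - 1 <= s).
Proof.
intros Hs. apply Rabs_le_between in Hs.
assert (H1 := exp_ineq1_le s). assert (Hx := exp_pos s). assert (H3 := exp_mul_le_1 s).
split; intros H.
- nra.
- assert (H4 : (exp s * (1 - s)) ^ 2 <= 1).
  { rewrite <- (pow1 2). apply pow_incr. split; [apply Rmult_le_pos; lra | lra]. }
  apply (Rmult_le_reg_r ((1 - s) ^ 2)); [apply pow_lt; lra |].
  replace ((exp s ^ 2 - 1) * (1 - s) ^ 2) with ((exp s * (1 - s)) ^ 2 - (1 - s) ^ 2) by ring.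
  nra.
Qed.

Lemma Rabs_exp_minus_one_le (s : R) : Rabs s <= 1 / 2 -> Rabs (exp s - 1) <= 2 * Rabs s.
Proof.
intros Hs. assert (Hs' := proj1 (Rabs_le_between _ _) Hs).
assert (H1 := exp_ineq1_le s). assert (Hx := exp_pos s). assert (H3 := exp_mul_le_1 s).
apply Rabs_le. unfold Rabs. destruct (Rcase_abs s); nra.
Qed.

(** Freezing the field outside [|s| <= 1/2] makes it globally bounded; the solutions
    of interest stay inside. *)
Definition clamp (s : R) : R := Rmax (- (1 / 2)) (Rmin (1 / 2) s).

Lemma clamp_bound (s : R) : Rabs (clamp s) <= 1 / 2.
Proof.
apply Rabs_le. unfold clamp, Rmax, Rmin. repeat destruct (Rle_dec _ _); lra.
Qed.

Lemma clamp_id (s : R) : Rabs s <= 1 / 2 -> clamp s = s.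
Proof.
intros H. apply Rabs_le_between in H.
unfold clamp. rewrite Rmin_right, Rmax_right; lra.
Qed.

Lemma clamp_lipschitz (s t : R) : Rabs (clamp s - clamp t) <= Rabs (s - t).
Proof.
unfold clamp, Rmax, Rmin, Rabs. repeat destruct (Rle_dec _ _); repeat destruct (Rcase_abs _); lra.
Qed.

Lemma continuous_clamp (s : R) : continuous clamp s.
Proof.
apply filterlim_locally. intros eta. exists eta. intros t Ht.
apply Rle_lt_trans with (2 := Ht). apply (clamp_lipschitz t s).
Qed.

Lemma polar_force_continuous (Z : UniformSpace) (k : nat) (E : R * R * R -> R) (eps : R)
  (TH S : Z -> R) (z : Z) :
  (forall p, continuous E p) -> continuous TH z -> continuous S z ->
  continuous (fun z => polar_force k E eps (TH z) (S z)) z.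
Proof.
intros HE HTH HS.
assert (Hexp : continuous (fun z => exp (S z)) z)
  by (apply (continuous_comp S exp); [exact HS | apply continuous_exp]).
assert (Hc : continuous (fun z => exp (S z) * cos (TH z)) z).
{ apply (continuous_mult (fun z => exp (S z))); [exact Hexp |].
  apply (continuous_comp TH cos); [exact HTH | apply continuous_cos]. }
unfold polar_force.
apply (continuous_plus (fun z => rhs k E eps (exp (S z) * cos (TH z))
                                   (- (exp (S z) * sin (TH z))))); [| exact Hc].
apply rhs_continuous; [exact HE | exact Hc |].
apply (continuous_opp (fun z => exp (S z) * sin (TH z))).
apply (continuous_mult (fun z => exp (S z))); [exact Hexp |].
apply (continuous_comp TH sin); [exact HTH | apply continuous_sin].
Qed.

Lemma angular_speed_continuous (Z : UniformSpace) (k : nat) (E : R * R * R -> R) (eps : R)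
  (TH S : Z -> R) (z : Z) :
  (forall p, continuous E p) -> continuous TH z -> continuous S z ->
  continuous (fun z => angular_speed k E eps (TH z) (S z)) z.
Proof.
intros HE HTH HS. unfold angular_speed.
apply (continuous_minus (fun _ => 1)); [apply continuous_const |].
apply (continuous_mult (fun z => exp (- S z) * polar_force k E eps (TH z) (S z))).
- apply (continuous_mult (fun z => exp (- S z))); [| now apply polar_force_continuous].
  apply (continuous_comp (fun z => - S z) exp); [now apply (continuous_opp S) |].
  apply continuous_exp.
- apply (continuous_comp TH cos); [exact HTH | apply continuous_cos].
Qed.

Lemma radial_slope_continuous (Z : UniformSpace) (k : nat) (E : R * R * R -> R) (eps : R)
  (TH S : Z -> R) (z : Z) :
  (forall p, continuous E p) -> continuous TH z -> continuous S z ->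
  angular_speed k E eps (TH z) (S z) <> 0 ->
  continuous (fun z => radial_slope k E eps (TH z) (S z)) z.
Proof.
intros HE HTH HS HD. unfold radial_slope, Rdiv.
apply (continuous_mult (fun z => - (exp (- S z) * polar_force k E eps (TH z) (S z) * sin (TH z)))).
- apply (continuous_opp (fun z => exp (- S z) * polar_force k E eps (TH z) (S z) * sin (TH z))).
  apply (continuous_mult (fun z => exp (- S z) * polar_force k E eps (TH z) (S z))).
  + apply (continuous_mult (fun z => exp (- S z))); [| now apply polar_force_continuous].
    apply (continuous_comp (fun z => - S z) exp); [now apply (continuous_opp S) |].
    apply continuous_exp.
  + apply (continuous_comp TH sin); [exact HTH | apply continuous_sin].
- apply (continuous_comp (fun z => angular_speed k E eps (TH z) (S z)) Rinv);
    [now apply angular_speed_continuous |].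
  apply continuity_pt_filterlim, continuity_pt_inv; [reg | exact HD].
Qed.

Lemma polar_field_periodic (k : nat) (E : R * R * R -> R) (eps th s : R) :
  angular_speed k E eps (th + 2 * PI) s = angular_speed k E eps th s /\
  radial_slope k E eps (th + 2 * PI) s = radial_slope k E eps th s.
Proof.
assert (Hc : cos (th + 2 * PI) = cos th) by (rewrite cos_plus, cos_2PI, sin_2PI; ring).
assert (Hs : sin (th + 2 * PI) = sin th) by (rewrite sin_plus, cos_2PI, sin_2PI; ring).
unfold radial_slope, angular_speed, polar_force. now rewrite Hc, Hs.
Qed.

(** While [end_gap M * |eps| <= |s| <= 1/2] and [0 < |eps| <= 1], the cube root
    [cbrt (exp s ^ 2 - 1)] exceeds [12 M |eps|] in absolute value and so beats the
    perturbation [E]: this is where the infinite slope of the cube root matters. *)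
Definition end_gap (M : R) : R := (12 * M) ^ 3 + 1.

Lemma end_gap_ge_1 (M : R) : 0 <= M -> 1 <= end_gap M.
Proof.
intros M0. unfold end_gap. assert (0 <= (12 * M) ^ 3) by (apply pow_le; lra). lra.
Qed.

(** During one turn [s] changes by at most [4 (8 + M) |eps| * 2 PI], which is below
    [32 (8 + M) |eps|]; starting from [end_radius M * |eps|] therefore leaves
    [end_gap M * |eps|] throughout the turn. *)
Definition end_radius (M : R) : R := end_gap M + 32 * (8 + M).

(** The two endpoints [s 0 = +- end_radius M * |eps|] are both pushed outwards when
    [eps ^ k > 0] and both inwards when [eps ^ k < 0]; [tau] is the side. *)
Lemma return_sign (k : nat) (E : R * R * R -> R) (M eps tau : R) (s : R -> R) :
  (forall x y z, Rabs x <= 2 -> Rabs y <= 2 -> Rabs z <= 2 -> Rabs (E (x, y, z)) <= M) ->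
  (0 < k)%nat -> 0 <= M -> eps <> 0 ->
  (end_radius M + 32 * (8 + M)) * Rabs eps <= 1 / 2 -> tau = 1 \/ tau = -1 ->
  solves_forward (fun t y => radial_slope k E eps t (clamp y)) (4 * (8 + M) * Rabs eps) s ->
  s 0 = tau * (end_radius M * Rabs eps) ->
  0 < tau * eps ^ k * (s (2 * PI) - s 0).
Proof.
intros HM Hk M0 He0 He Htau [Hder Hlip] Hs0.
assert (HPI := PI_RGT_0). assert (HPI4 := PI_4). assert (Hea := Rabs_pos_lt eps He0).
assert (Hgap := end_gap_ge_1 M M0).
unfold end_radius in *.
assert (Hsmall : (8 + M) * Rabs eps <= 1 / 4) by nra.
assert (He1 : Rabs eps <= 1) by nra.
(* Two-sided continuity at 0 is obtained by making [s] constant on the past. *)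
set (s' := fun t => s (Rmax 0 t)).
assert (Hs' : forall t, 0 <= t -> s' t = s t)
  by (intros t Ht; unfold s'; now rewrite Rmax_right).
assert (Hnear : forall t, 0 <= t <= 2 * PI -> Rabs (s' t - s 0) <= 32 * (8 + M) * Rabs eps).
{ intros t Ht. rewrite Hs' by lra. eapply Rle_trans; [apply Hlip; lra |].
  replace (32 * (8 + M) * Rabs eps) with (4 * (8 + M) * Rabs eps * 8) by ring.
  apply Rmult_le_compat_l; [nra | lra]. }
assert (Htau_s : forall t, 0 <= t <= 2 * PI ->
  Rabs (s' t) <= 1 / 2 /\ end_gap M * Rabs eps <= tau * s' t).
{ intros t Ht. specialize (Hnear t Ht). apply Rabs_le_between in Hnear.
  rewrite Hs0 in Hnear.
  assert (0 <= end_gap M * Rabs eps) by nra.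
  assert (0 <= M * Rabs eps) by nra.
  split; [apply Rabs_le |]; destruct Htau; subst tau; lra. }
rewrite <- (Hs' (2 * PI)), <- (Hs' 0) by lra.
apply (return_displacement k E M eps tau (cbrt (end_gap M * Rabs eps)) s'); try assumption.
- apply Rabs_le. destruct Htau; lra.
- apply Rnot_le_lt. intros H.
  assert (H3 : cbrt (end_gap M * Rabs eps) ^ 3 <= (12 * M * Rabs eps) ^ 3).
  { destruct H as [H | ->]; [left; now apply pow3_lt | right; reflexivity]. }
  rewrite cbrt_pow3 in H3. unfold end_gap in H3.
  replace ((12 * M * Rabs eps) ^ 3) with ((12 * M) ^ 3 * Rabs eps * Rabs eps ^ 2) in H3 by ring.
  assert (0 <= (12 * M) ^ 3 * Rabs eps)
    by (apply Rmult_le_pos; [apply pow_le; lra | lra]).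
  assert (Rabs eps ^ 2 <= 1) by nra. nra.
- intros t Ht. destruct (Htau_s t Ht) as [H1 H2]. split; [exact H1 |].
  destruct (exp_sq_minus_one_bounds (s' t) H1) as [H3 H4].
  assert (0 < end_gap M * Rabs eps) by nra.
  destruct Htau; subst tau.
  + rewrite Rmult_1_l in *. apply cbrt_le. specialize (H3 ltac:(lra)). lra.
  + apply Ropp_le_cancel. replace (- (-1 * cbrt (exp (s' t) ^ 2 - 1)))
      with (cbrt (exp (s' t) ^ 2 - 1)) by ring.
    rewrite <- cbrt_opp. apply cbrt_le. specialize (H4 ltac:(lra)). lra.
- intros t Ht. rewrite Hs' by lra.
  destruct (Htau_s t ltac:(lra)) as [H1 _]. rewrite Hs' in H1 by lra.
  rewrite <- (clamp_id (s t) H1) at 1.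
  apply (is_derive_ext_loc s); [| apply Hder; lra].
  assert (Ht0 : 0 < t) by lra.
  exists (mkposreal t Ht0). intros u Hu. apply Rabs_lt_between' in Hu. cbn [pos] in Hu.
  symmetry. apply Hs'. lra.
- intros t Ht. apply continuity_pt_filterlim, filterlim_locally. intros eta.
  assert (Heta := cond_pos eta).
  set (L := 4 * (8 + M) * Rabs eps) in *.
  assert (HL : 0 <= L <= 1) by (unfold L; nra).
  exists eta. intros u Hu. apply Rle_lt_trans with (2 := Hu).
  change (Rabs (s' u - s' t) <= Rabs (u - t)).
  assert (Hgen : forall u v, u <= v -> Rabs (s' v - s' u) <= v - u).
  { intros u' v' Huv. unfold s'.
    assert (Hm : 0 <= Rmax 0 u' <= Rmax 0 v' /\ Rmax 0 v' - Rmax 0 u' <= v' - u').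
    { unfold Rmax. repeat destruct (Rle_dec _ _); lra. }
    eapply Rle_trans; [apply Hlip; apply Hm |]. nra. }
  destruct (Rle_dec t u) as [H | H].
  + rewrite (Rabs_right (u - t)) by lra. now apply Hgen.
  + rewrite (Rabs_minus_sym (s' u)), (Rabs_minus_sym u), (Rabs_right (t - u)) by lra.
    apply Hgen. lra.
Qed.

Lemma periodic_orbit_polar (k : nat) (E : R * R * R -> R) (M eps : R) :
  (forall p, continuous E p) ->
  (forall x y z, Rabs x <= 2 -> Rabs y <= 2 -> Rabs z <= 2 -> Rabs (E (x, y, z)) <= M) ->
  (0 < k)%nat -> 0 <= M -> eps <> 0 ->
  (end_radius M + 32 * (8 + M)) * Rabs eps <= 1 / 2 ->
  exists s : R -> R,
    (forall t, is_derive s t (radial_slope k E eps t (s t))) /\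
    (forall t, s (t + 2 * PI) = s t) /\
    (forall t, Rabs (s t) <= (end_radius M + 32 * (8 + M)) * Rabs eps).
Proof.
intros HE HM Hk M0 He0 He.
assert (HPI := PI_RGT_0). assert (HPI4 := PI_4). assert (Hea := Rabs_pos_lt eps He0).
assert (Hgap := end_gap_ge_1 M M0).
assert (Hrad : 0 < end_radius M) by (unfold end_radius; lra).
assert (Hsmall : (8 + M) * Rabs eps <= 1 / 4) by nra.
destruct (periodic_solution_between (fun t y => radial_slope k E eps t (clamp y))
  (4 * (8 + M) * Rabs eps) (2 * PI) (eps ^ k)
  (-1 * (end_radius M * Rabs eps)) (1 * (end_radius M * Rabs eps)))
  as [s [c [Hc [Hder [Hper Hnear]]]]].
- intros t y. apply continuity_2d_pt_filterlim.
  apply (radial_slope_continuous _ k E eps (fun p : R * R => fst p)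
           (fun p : R * R => clamp (snd p)) (t, y) HE).
  + apply continuous_fst.
  + apply (continuous_comp (fun p : R * R => snd p) clamp);
      [apply continuous_snd | apply continuous_clamp].
  + destruct (polar_field_bounds k E M eps t (clamp y) HM Hk M0 Hsmall (clamp_bound y))
      as [H _]. simpl. lra.
- intros t y. now apply polar_field_bounds; [| | | | apply clamp_bound].
- lra.
- intros t y. apply polar_field_periodic.
- assert (0 <= end_radius M * Rabs eps) by nra. lra.
- intros s Hs Hs0.
  assert (H := return_sign k E M eps (-1) s HM Hk M0 He0 He (or_intror eq_refl) Hs Hs0).
  rewrite Hs0 in H. lra.
- intros s Hs Hs0.
  assert (H := return_sign k E M eps 1 s HM Hk M0 He0 He (or_introl eq_refl) Hs Hs0).
  rewrite Hs0 in H. lra.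
- assert (Hbound : forall t, Rabs (s t) <= (end_radius M + 32 * (8 + M)) * Rabs eps).
  { intros t. specialize (Hnear t).
    assert (H : 4 * (8 + M) * Rabs eps * (2 * PI) <= 4 * (8 + M) * Rabs eps * 8)
      by (apply Rmult_le_compat_l; [nra | lra]).
    apply Rabs_le_between in Hnear. apply Rabs_le. lra. }
  exists s. split; [| split; [exact Hper | exact Hbound]].
  intros t. specialize (Hder t). simpl in Hder.
  rewrite clamp_id in Hder; [exact Hder |]. specialize (Hbound t). lra.
Qed.

(** * The periodic orbits and their distance to the circle *)

Lemma polar_derive (y th : R -> R) (t dy dth : R) :
  is_derive y t dy -> is_derive th t dth ->
  is_derive (fun t => exp (y t) * cos (th t)) t
    (exp (y t) * (dy * cos (th t) - dth * sin (th t))) /\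
  is_derive (fun t => - (exp (y t) * sin (th t))) t
    (- (exp (y t) * (dy * sin (th t) + dth * cos (th t)))).
Proof.
intros Hy Hth.
assert (Hey : ex_derive (fun x : R => y x) t) by (eexists; exact Hy).
assert (Het : ex_derive (fun x : R => th x) t) by (eexists; exact Hth).
assert (HDy : Derive (fun x : R => y x) t = dy) by (apply is_derive_unique; exact Hy).
assert (HDt : Derive (fun x : R => th x) t = dth) by (apply is_derive_unique; exact Hth).
split; (auto_derive; [tauto | rewrite HDy, HDt; ring]).
Qed.

Lemma periodic_orbit (k : nat) (E : R * R * R -> R) (M eps : R) :
  (forall p, continuous E p) ->
  (forall x y z, Rabs x <= 2 -> Rabs y <= 2 -> Rabs z <= 2 -> Rabs (E (x, y, z)) <= M) ->
  (0 < k)%nat -> 0 <= M -> eps <> 0 ->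
  (end_radius M + 32 * (8 + M)) * Rabs eps <= 1 / 2 ->
  exists x : R -> R, is_solution k E eps x /\ periodic x /\
    forall t, exists s th, Rabs s <= (end_radius M + 32 * (8 + M)) * Rabs eps /\
      x t = exp s * cos th /\ Derive x t = - (exp s * sin th).
Proof.
intros HE HM Hk M0 He0 He.
destruct (periodic_orbit_polar k E M eps HE HM Hk M0 He0 He) as [s [Hs [Hper Hbound]]].
assert (HPI := PI_RGT_0). assert (Hea := Rabs_pos_lt eps He0).
assert (Hgap := end_gap_ge_1 M M0).
assert (Hrad : 0 < end_radius M) by (unfold end_radius; lra).
assert (Hsmall : (8 + M) * Rabs eps <= 1 / 4) by nra.
assert (Hhalf : forall t, Rabs (s t) <= 1 / 2)
  by (intros t; specialize (Hbound t); lra).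
assert (HG : forall u, 1 / 2 <= angular_speed k E eps u (s u) <= 3 / 2)
  by (intros u; apply (polar_field_bounds k E M eps u (s u)); auto).
destruct (autonomous_flow (fun u => angular_speed k E eps u (s u)) (2 * PI))
  as [th [P [HP [Hth [Hthper Hsurj]]]]].
- lra.
- intros u. apply (angular_speed_continuous _ k E eps (fun u => u) s u HE).
  + apply continuous_id.
  + apply (ex_derive_continuous s). eexists. apply Hs.
- intros u. specialize (HG u). lra.
- intros u. rewrite Hper. apply polar_field_periodic.
- set (x := fun t => exp (s (th t)) * cos (th t)).
  set (v := fun t => - (exp (s (th t)) * sin (th t))).
  assert (Hxv : forall t, is_derive x t (v t) /\ is_derive v t (rhs k E eps (x t) (v t))).
  { intros t. assert (HGt := HG (th t)).
    assert (Hy : is_derive (fun t => s (th t)) t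
      (- (exp (- s (th t)) * polar_force k E eps (th t) (s (th t)) * sin (th t)))).
    { replace (- _) with (scal (angular_speed k E eps (th t) (s (th t)))
                            (radial_slope k E eps (th t) (s (th t)))).
      - apply (is_derive_comp s th); [apply Hs | apply Hth].
      - unfold scal; simpl; unfold mult; simpl. unfold radial_slope. field. lra. }
    destruct (polar_derive _ _ _ _ _ Hy (Hth t)) as [H1 H2].
    assert (Hinv : exp (s (th t)) * exp (- s (th t)) = 1)
      by (rewrite <- exp_plus, Rplus_opp_r; apply exp_0).
    assert (Hrhs : rhs k E eps (x t) (v t)
                   = polar_force k E eps (th t) (s (th t)) - x t)
      by (unfold polar_force, x, v; ring).
    assert (Hc := cos_sin_sq (th t)).
    unfold angular_speed in H1, H2.
    split.
    - replace (v t) with (exp (s (th t)) *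
        (- (exp (- s (th t)) * polar_force k E eps (th t) (s (th t)) * sin (th t)) * cos (th t) -
         (1 - exp (- s (th t)) * polar_force k E eps (th t) (s (th t)) * cos (th t)) * sin (th t)));
        [exact H1 | unfold v; ring].
    - rewrite Hrhs.
      replace (polar_force k E eps (th t) (s (th t)) - x t) with (- (exp (s (th t)) *
        (- (exp (- s (th t)) * polar_force k E eps (th t) (s (th t)) * sin (th t)) * sin (th t) +
         (1 - exp (- s (th t)) * polar_force k E eps (th t) (s (th t)) * cos (th t)) * cos (th t))));
        [exact H2 |].
      unfold x. set (F := polar_force k E eps (th t) (s (th t))).
      transitivity ((exp (s (th t)) * exp (- s (th t))) * F * (sin (th t) ^ 2 + cos (th t) ^ 2)
                    - exp (s (th t)) * cos (th t)); [ring |].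
      rewrite Hinv, Hc. ring. }
  assert (HDx : forall t, Derive x t = v t)
    by (intros t; apply is_derive_unique, Hxv).
  exists x. split; [| split; [split |]].
  + intros t. split; [exists (v t); apply Hxv |].
    rewrite HDx. apply (is_derive_ext v); [intros u; symmetry; apply HDx | apply Hxv].
  + exists P. split; [exact HP |]. intros t. unfold x. rewrite Hthper, Hper.
    now rewrite cos_plus, cos_2PI, sin_2PI, Rmult_1_r, Rmult_0_r, Rminus_0_r.
  (* [x] is positive at angle 0 and negative at angle [PI]. *)
  + destruct (Hsurj 0) as [t0 Ht0]. destruct (Hsurj PI) as [t1 Ht1].
    exists t0, t1. unfold x. rewrite Ht0, Ht1, cos_0, cos_PI.
    assert (H0 := exp_pos (s 0)). assert (H1 := exp_pos (s PI)). lra.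
  + intros t. exists (s (th t)), (th t). rewrite HDx. repeat split. apply Hbound.
Qed.

Lemma dist_set_le (p q : R * R) (A : R * R -> Prop) : A q -> dist_set p A <= dist2 p q.
Proof.
intros Hq. unfold dist_set.
destruct (Glb_Rbar_correct (fun d => exists q, A q /\ d = dist2 p q)) as [Hlb Hglb].
assert (H1 := Hlb (dist2 p q) (ex_intro _ q (conj Hq eq_refl))).
assert (H0 : is_lb_Rbar (fun d => exists q, A q /\ d = dist2 p q) 0).
{ intros d [q' [_ ->]]. apply sqrt_pos. }
apply Hglb in H0. destruct (Glb_Rbar _); simpl in *; [exact H1 | contradiction | contradiction].
Qed.

Lemma dist_circle_le (s th : R) :
  dist_set (exp s * cos th, - (exp s * sin th)) S1 <= Rabs (exp s - 1).
Proof.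
eapply Rle_trans; [apply (dist_set_le _ (cos th, - sin th)) |].
- unfold S1. simpl fst. simpl snd. rewrite cos_sin_sq. ring.
- unfold dist2. simpl fst. simpl snd. rewrite <- sqrt_Rsqr_abs. right. f_equal.
  unfold Rsqr. transitivity ((exp s - 1) ^ 2 * (cos th ^ 2 + sin th ^ 2)); [ring |].
  rewrite cos_sin_sq. ring.
Qed.

Theorem proposition2 :
  forall (k : nat) (E : R * R * R -> R),
    (0 < k)%nat ->
    (forall p : R * R * R, continuous E p) ->
    exists (eps0 : R) (x : R -> R -> R),
      0 < eps0 /\
      (forall eps : R, 0 < Rabs eps < eps0 ->
         is_solution k E eps (x eps) /\ periodic (x eps)) /\
      (forall eta : R, 0 < eta ->
         exists delta : R, 0 < delta /\
           forall eps : R, 0 < Rabs eps < Rmin eps0 delta ->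
             forall t : R, dist_set (x eps t, Derive (x eps) t) S1 < eta).
Proof.
intros k E Hk HE.
destruct (continuous_bounded_on_box E 2 HE) as [M [M0 HM]].
set (C := end_radius M + 32 * (8 + M)).
assert (HC : 0 < C).
{ unfold C, end_radius. assert (H := end_gap_ge_1 M M0). lra. }
assert (Hsmall : forall eps, Rabs eps < / (2 * C) -> C * Rabs eps <= 1 / 2).
{ intros eps He. apply (Rmult_lt_compat_l (2 * C)) in He; [| lra].
  rewrite Rinv_r in He; lra. }
destruct (functional_choice (fun eps x => 0 < Rabs eps < / (2 * C) ->
  is_solution k E eps x /\ periodic x /\
  forall t, exists s th, Rabs s <= C * Rabs eps /\
    x t = exp s * cos th /\ Derive x t = - (exp s * sin th))) as [x Hx].
{ intros eps. destruct (Rlt_dec (Rabs eps) (/ (2 * C))) as [H | H];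
    [| exists (fun _ => 0); intros H'; lra].
  destruct (Req_dec eps 0) as [-> | He].
  { exists (fun _ => 0). rewrite Rabs_R0. intros H'. lra. }
  destruct (periodic_orbit k E M eps HE HM Hk M0 He (Hsmall eps H)) as [x Hx].
  now exists x. }
exists (/ (2 * C)), x. split; [apply Rinv_0_lt_compat; lra |]. split.
- intros eps He. destruct (Hx eps He) as [H1 [H2 _]]. now split.
- intros eta Heta. exists (eta / (2 * C)). split; [apply Rdiv_lt_0_compat; lra |].
  intros eps [He1 He2] t.
  assert (He3 := Rlt_le_trans _ _ _ He2 (Rmin_l _ _)).
  assert (He4 := Rlt_le_trans _ _ _ He2 (Rmin_r _ _)).
  destruct (Hx eps (conj He1 He3)) as [_ [_ Hpolar]].
  destruct (Hpolar t) as [s [th [Hs [-> ->]]]].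
  eapply Rle_lt_trans; [apply dist_circle_le |].
  eapply Rle_lt_trans;
    [apply Rabs_exp_minus_one_le; specialize (Hsmall eps He3); lra |].
  apply (Rmult_lt_compat_l (2 * C)) in He4; [| lra].
  replace (2 * C * (eta / (2 * C))) with eta in He4 by (field; lra). lra.
Qed.
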